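(* Let $W$ be a non-degenerate invertible potential in $N$ variables and let $G\subseteq G_W^{\max}$ be a group of diagonal symmetries of $W$. Let $W^T$ be the transposed potential and $G^T\subseteq G^{\max}_{W^T}$ the dual group. Then there is a bi-graded isomorphism of vector spaces \[\mathscr{H}_{W,G}\;\cong\;\mathscr{Q}_{W^T,G^T},\] where $\mathscr{H}_{W,G}$ is the state space of the FJRW $A$-model of $(W,G)$ with its $A$-model bi-grading, and $\mathscr{Q}_{W^T,G^T}$ is the state space of the orbifold $B$-model of $(W^T,G^T)$ with its $B$-model bi-grading.
   Context: Invertible potentials. An invertible potential is a quasi-homogeneous polynomial $W=\sum_{i=1}^N\prod_{j=1}^N X_j^{a_{ij}}$ with as many monomials as variables (coefficients are normalized to $1$ by rescaling variables). Its exponent matrix is $A=(a_{ij})$. It is non-degenerate if its charges $q_1,\dots,q_N\in\mathbb{Q}$, determined by $A(q_1,\dots,q_N)^T=(1,\dots,1)^T$, are uniquely determined (so $\det A\neq 0$) and $W$ has an isolated critical point at the origin. By Kreuzer--Skarke, $W$ is non-degenerate iff, up to renaming variables, it is a sum, in disjoint sets of variables, of potentials of the types Fermat $X^a$, loop $X_1^{a_1}X_2+X_2^{a_2}X_3+\dots+X_{n-1}^{a_{n-1}}X_n+X_n^{a_n}X_1$, and chain $X_1^{a_1}X_2+\dots+X_{n-1}^{a_{n-1}}X_n+X_n^{a_n}$. Standing assumption: all these exponents satisfy $a_i\ge 2$ (so all $q_i\le\frac12$). Transpose and symmetries. $W^T=\sum_{i=1}^N\prod_{j=1}^N Y_j^{a_{ji}}$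 is the potential with exponent matrix $A^T$; its charges are denoted $\overline q_i$. $G^{\max}_W=\{(\lambda_1,\dots,\lambda_N)\in(\mathbb{C}^* )^N: W(\lambda_1X_1,\dots,\lambda_NX_N)=W(X_1,\dots,X_N)\}$ is the maximal group of diagonal symmetries. Let $\rho_k\in G_W^{\max}$ act by $\rho_kX_j=\exp(2\pi i(A^{-1})_{jk})X_j$ and let $\overline\rho_k\in G^{\max}_{W^T}$ act by $\overline\rho_kY_j=\exp(2\pi i(A^{-1})_{kj})Y_j$; these generate $G^{\max}_W$ and $G^{\max}_{W^T}$ respectively. The dual group of $G\subseteq G^{\max}_W$ is \[G^T=\Bigl\{\prod_{i=1}^N\overline\rho_i^{\,r_i}\ :\ [r_1,\dots,r_N]A^{-1}[b_1,\dots,b_N]^T\in\mathbb{Z}\ \text{ for all }\prod_{i=1}^N\rho_i^{b_i}\in G\Bigr\}.\] State spaces. For a potential $V$ in $N$ variables with charges $p_i$ and a group $K$ of diagonal symmetries of $V$: for $h=(e^{2\pi i\Theta_1^h},\dots,e^{2\pi i\Theta_N^h})\in K$ with $0\le\Theta_j^h<1$, let $\mathrm{Fix}\,h\subseteq\mathbb{C}^N$ be the fixed locus, a coordinate subspace with coordinates the variables of index $i$ with $\Theta_i^h=0$. Put $\mathscr{H}_h=\mathscr{Q}_h=\mathscr{Q}_{V|_{\mathrm{Fix}\,h}}\cdot\omega_h$, where $\mathscr{Q}_{V|_{\mathrm{Fix}\,h}}$ is the Milnor ring (polynomial ring in the fixed variables modulo the partial derivatives of $V|_{\mathrm{Fix}\,h}$;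 it is $\mathbb{C}$ if $\mathrm{Fix}\,h=0$) and $\omega_h$ is the standard volume form $\bigwedge dx_i$ on $\mathrm{Fix}\,h$. $K$ acts on the variables and on $\omega_h$ (so the action is twisted by the determinant on $\mathrm{Fix}\,h$). Both the $A$-model state space $\mathscr{H}_{V,K}$ and the $B$-model state space $\mathscr{Q}_{V,K}$ are, as vector spaces, the invariants $\bigl(\bigoplus_{h\in K}\mathscr{Q}_{V|_{\mathrm{Fix}\,h}}\,\omega_h\bigr)^K$. Bi-gradings. An element of the $h$-sector given by a monomial of weighted degree $p$ (the weight of the monomial with respect to the charges $p_i$, not counting $\omega_h$) has $A$-model bi-degree $(Q^A_++p,\;Q^A_--p)$ and $B$-model bi-degree $(Q^B_++p,\;Q^B_-+p)$, where \[Q^A_+=\sum_{\Theta^h_i\ne 0}(\Theta^h_i-p_i),\qquad Q^A_-=\sum_{\Theta^h_i\neq 0}(\Theta^h_i-p_i)+\sum_{\Theta^h_i=0}(1-2p_i),\] \[Q^B_+=\sum_{\Theta^h_i\ne 0}(\Theta^h_i-p_i),\qquad Q^B_-=\sum_{\Theta^h_i\ne 0}(1-\Theta^h_i-p_i).\] A bi-graded isomorphism is a linear isomorphism taking $A$-model bi-degree to $B$-model bi-degree. For $\mathscr{H}_{W,G}$ the charges are the $q_i$, for $\mathscr{Q}_{W^T,G^T}$ they are the $\overline q_i$. *)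

(* Defs.v *)
From HB Require Import structures.
From mathcomp Require Import all_boot all_order all_algebra.
From mathcomp Require Import generic_quotient ring_quotient.
From mathcomp Require Import mpoly complex.
From mathcomp Require Import boolp classical_sets cardinality reals trigo.

Set Implicit Arguments.
Unset Strict Implicit.
Unset Printing Implicit Defensive.

Import Order.TTheory GRing.Theory Num.Theory.

Local Open Scope ring_scope.
Local Open Scope quotient_scope.

(** * Milnor rings, as vector spaces *)

Section Milnor.
Variables (F : fieldType) (n : nat).
Implicit Types (V p : {mpoly F[n]}).

Definition jacobian V : {pred {mpoly F[n]}} :=
  fun p => `[< exists c : 'I_n -> {mpoly F[n]}, p = \sum_i c i * V^`M(i) >].

Lemma jacobian_submod_closed V : submod_closed (jacobian V).
Proof.
split=> [|a p q /asboolP [c ->] /asboolP [d ->]]; apply/asboolP.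
  by exists (fun=> 0); rewrite big1 // => i _; rewrite mul0r.
exists (fun i => a *: c i + d i); rewrite scaler_sumr -big_split /=.
by apply: eq_bigr => i _; rewrite mulrDl scalerAl.
Qed.

HB.instance Definition _ V :=
  GRing.isSubmodClosed.Build F {mpoly F[n]} (jacobian V)
    (jacobian_submod_closed V).

Definition milnor V : Type := Quotient.quot (jacobian V).

HB.instance Definition _ V := GRing.Zmodule.on (milnor V).

Definition milnor_class V p : milnor V := \pi_(Quotient.quot (jacobian V)) p.

Lemma milnor_classP V p q :
  reflect (milnor_class V p = milnor_class V q) (p - q \in jacobian V).
Proof. by rewrite Quotient.idealrBE; apply: eqP. Qed.

Lemma milnor_classK V (x : milnor V) :
  milnor_class V (repr (x : Quotient.quot (jacobian V))) = x.
Proof. exact: reprK. Qed.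

Lemma milnor_classD V p q :
  milnor_class V (p + q) = milnor_class V p + milnor_class V q.
Proof. exact: raddfD. Qed.

Definition milnor_scale V (a : F) (x : milnor V) : milnor V :=
  milnor_class V (a *: repr (x : Quotient.quot (jacobian V))).

Lemma milnor_scale_class V a p :
  milnor_scale a (milnor_class V p) = milnor_class V (a *: p).
Proof.
apply/milnor_classP; rewrite -scalerBr rpredZ //.
by apply/milnor_classP; rewrite milnor_classK.
Qed.

Fact milnor_scaleA V a b (x : milnor V) :
  milnor_scale a (milnor_scale b x) = milnor_scale (a * b) x.
Proof. by rewrite -[x]milnor_classK !milnor_scale_class scalerA. Qed.

Fact milnor_scale1 V : left_id 1 (@milnor_scale V).
Proof. by move=> x; rewrite -[x]milnor_classK milnor_scale_class scale1r. Qed.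

Fact milnor_scaleDr V : right_distributive (@milnor_scale V) +%R.
Proof.
move=> a x y; rewrite -[x]milnor_classK -[y]milnor_classK -milnor_classD.
by rewrite !milnor_scale_class scalerDr milnor_classD.
Qed.

Fact milnor_scaleDl V (x : milnor V) :
  {morph (@milnor_scale V)^~ x : a b / a + b}.
Proof.
move=> a b; rewrite -[x]milnor_classK.
by rewrite !milnor_scale_class scalerDl milnor_classD.
Qed.

HB.instance Definition _ V := GRing.Zmodule_isLmodule.Build F (milnor V)
  (@milnor_scaleA V) (@milnor_scale1 V) (@milnor_scaleDr V) (@milnor_scaleDl V).

Lemma milnor_classZ V a p : milnor_class V (a *: p) = a *: milnor_class V p.
Proof. by rewrite -milnor_scale_class. Qed.

End Milnor.

(** * Sectors and state spaces *)

Section StateSpace.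
Variables (F : fieldType) (n : nat).
Implicit Types (V : {mpoly F[n]}) (h k : 'I_n -> F) (K : set ('I_n -> F)).

Definition fix_set h : {set 'I_n} := [set i | h i == 1].

(* Restriction to the coordinate subspace [I]: the variables outside [I] are set
   to 0; the variables of the result are the elements of [I] in increasing
   order, the [j]-th one being [enum_val j]. *)
Definition restrict_to (I : {set 'I_n}) V : {mpoly F[#|I|]} :=
  V \mPo [tuple if [pick j : 'I_#|I| | enum_val j == i] is Some j
                then 'X_j else 0 | i < n].

Definition sector V h := milnor (restrict_to (fix_set h) V).

(* The product of all the sectors; [state_pred] below cuts out the invariants
   of the direct sum of those indexed by the group. The volume form [omega_h] is
   not part of the data: it only enters through the twist in [form_action]. *)
Definition sectors V : Type := forall h, sector V h.

HB.instance Definition _ V := Choice.copy (sectors V) (forall h, sector V h).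

Fact sectors_addA V : associative (fun x y : sectors V => fun h => x h + y h).
Proof. by move=> x y z; apply: functional_extensionality_dep => h; exact: addrA. Qed.
Fact sectors_addC V : commutative (fun x y : sectors V => fun h => x h + y h).
Proof. by move=> x y; apply: functional_extensionality_dep => h; exact: addrC. Qed.
Fact sectors_add0 V : left_id ((fun=> 0) : sectors V) (fun x y => fun h => x h + y h).
Proof. by move=> x; apply: functional_extensionality_dep => h; exact: add0r. Qed.
Fact sectors_addN V : left_inverse ((fun=> 0) : sectors V)
  (fun x => fun h => - x h) (fun x y => fun h => x h + y h).
Proof. by move=> x; apply: functional_extensionality_dep => h; exact: addNr. Qed.

HB.instance Definition _ V := GRing.isZmodule.Build (sectors V)
  (@sectors_addA V) (@sectors_addC V) (@sectors_add0 V) (@sectors_addN V).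

Fact sectors_scaleA V a b (x : sectors V) :
  (fun h => a *: (b *: x h)) = (fun h => (a * b) *: x h).
Proof. by apply: functional_extensionality_dep => h; exact: scalerA. Qed.
Fact sectors_scale1 V : left_id 1 (fun a (x : sectors V) => fun h => a *: x h).
Proof. by move=> x; apply: functional_extensionality_dep => h; exact: scale1r. Qed.
Fact sectors_scaleDr V :
  right_distributive (fun a (x : sectors V) => fun h => a *: x h) +%R.
Proof. by move=> a x y; apply: functional_extensionality_dep => h; exact: scalerDr. Qed.
Fact sectors_scaleDl V (x : sectors V) :
  {morph (fun a => (fun h => a *: x h) : sectors V) : a b / a + b}.
Proof. by move=> a b; apply: functional_extensionality_dep => h; exact: scalerDl. Qed.

HB.instance Definition _ V := GRing.Zmodule_isLmodule.Build F (sectors V)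
  (@sectors_scaleA V) (@sectors_scale1 V) (@sectors_scaleDr V)
  (@sectors_scaleDl V).

(* [k] sends [p * omega_I] to [p(k X) * (\prod_(i in I) k i) * omega_I]. *)
Definition form_action (I : {set 'I_n}) k (p : {mpoly F[#|I|]}) :
    {mpoly F[#|I|]} :=
  (\prod_(i in I) k i) *: (p \mPo [tuple k (enum_val j) *: 'X_j | j < #|I|]).

(* When [k] is a symmetry of [V], [form_action] preserves the Jacobian ideal and
   this does not depend on the representative [p]; requiring it of some
   representative gives a linear subspace without assuming so. *)
Definition sector_invariant V h k (x : sector V h) : Prop :=
  exists2 p, milnor_class (restrict_to (fix_set h) V) p = x
           & milnor_class (restrict_to (fix_set h) V) (form_action k p) = x.

Definition state_pred V K : {pred sectors V} := fun x =>
  `[< [/\ finite_set [set h | x h <> 0],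
          (forall h, x h <> 0 -> K h)
        & (forall h k, K k -> sector_invariant k (x h))] >].

Lemma form_actionD (I : {set 'I_n}) k a (p q : {mpoly F[#|I|]}) :
  form_action k (a *: p + q) = a *: form_action k p + form_action k q.
Proof. by rewrite /form_action linearP scalerDr !scalerA mulrC. Qed.

Lemma state_submod_closed V K : submod_closed (@state_pred V K).
Proof.
split=> [|a x y /asboolP [xfin xK xinv] /asboolP [yfin yK yinv]].
  apply/asboolP; split=> [|h /(_ erefl) //|h k _].
    apply: (sub_finite_set _ (finite_set0 _)) => h /=; exact.
  have c0 : milnor_class (restrict_to (fix_set h) V) 0 = 0 by exact: raddf0.
  by exists 0; rewrite ?c0 //= /form_action linear0 scaler0 c0.
have sum_neq0 h : (a *: x + y) h <> 0 -> x h <> 0 \/ y h <> 0.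
  move=> xy0; have [x0|/eqP] := eqVneq (x h) 0; last by left.
  right=> y0; apply: xy0.
  by rewrite -[LHS]/(a *: x h + y h) x0 y0 scaler0 addr0.
apply/asboolP; split=> [|h /sum_neq0 [/xK|/yK] //|h k Kk].
  have xyfin : finite_set ([set h | x h <> 0] `|` [set h | y h <> 0])%classic.
    by rewrite finite_setU.
  by apply: sub_finite_set xyfin => h /sum_neq0.
have [p xp kp] := xinv h k Kk; have [q yq kq] := yinv h k Kk.
exists (a *: p + q); first by rewrite milnor_classD milnor_classZ xp yq.
by rewrite form_actionD milnor_classD milnor_classZ kp kq.
Qed.

HB.instance Definition _ V K :=
  GRing.isSubmodClosed.Build F (sectors V) (@state_pred V K)
    (@state_submod_closed V K).

Definition state_space V K : Type := {x : sectors V | x \in state_pred K}.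

HB.instance Definition _ V K := SubChoice.on (@state_space V K).
HB.instance Definition _ V K :=
  [SubChoice_isSubLmodule of @state_space V K by <:].

End StateSpace.

Arguments state_space {F n} V K.

(** * Invertible potentials *)

Section InvertiblePotential.
Variables (R : realType) (N : nat).
Local Notation C := R[i].
Implicit Types (A : 'M[nat]_N).

Definition potential A : {mpoly C[N]} := \sum_i \prod_j 'X_j ^+ A i j.

Definition exponent_mx A : 'M[rat]_N := map_mx (fun a => a%:R) A.

Definition charge A : 'cV[rat]_N := invmx (exponent_mx A) *m const_mx 1.

Definition isolated_critical_point_at_origin (V : {mpoly C[N]}) : Prop :=
  (forall i, V^`M(i).@[fun=> 0] = 0) /\
  exists2 e : R, 0 < e & forall x : 'I_N -> C,
    (forall i, `|x i| < e%:C%C) -> (forall i, V^`M(i).@[x] = 0) ->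
    forall i, x i = 0.

Definition non_degenerate A : Prop :=
  (exists! q : 'cV[rat]_N, exponent_mx A *m q = const_mx 1) /\
  isolated_critical_point_at_origin (potential A).

(* In a Fermat, loop or chain potential the [i]-th monomial is [X_i ^ a_i] or
   [X_i ^ a_i * X_k] with [k != i]; so all the exponents [a_i] are at least 2 iff
   every monomial contains some variable with exponent at least 2. *)
Definition exponents_ge2 A : Prop := forall i, exists j, (2 <= A i j)%N.

(** * Diagonal symmetries and the dual group *)

Definition expi2pi (t : R) : C := Complex (cos (2 * pi * t)) (sin (2 * pi * t)).

Definition Gmax A : set ('I_N -> C) := [set l | (forall i, l i != 0) /\
  potential A \mPo [tuple l i *: 'X_i | i < N] = potential A]%classic.

Definition torus_subgroup (G : set ('I_N -> C)) : Prop :=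
  [/\ G (fun=> 1),
      (forall g h, G g -> G h -> G (fun j => g j * h j))
    & (forall g, G g -> G (fun j => (g j)^-1))].

(* [rho A^T k] is the generator written [\overline\rho_k]. *)
Definition rho A (k : 'I_N) : 'I_N -> C :=
  fun j => expi2pi (ratr (invmx (exponent_mx A) j k)).

Definition rho_prod A (b : 'I_N -> int) : 'I_N -> C :=
  fun j => \prod_k rho A k j ^ b k.

Definition dual_group A (G : set ('I_N -> C)) : set ('I_N -> C) :=
  [set g | exists2 r : 'I_N -> int, g = rho_prod A^T r &
     forall b : 'I_N -> int, G (rho_prod A b) ->
       ((\row_i (r i)%:~R *m invmx (exponent_mx A) *m \col_i (b i)%:~R)
          : 'M[rat]_1) 0 0 \is a Num.int]%classic.

(** * Bi-gradings *)

(* The [t] in [0, 1[ such that [z = exp(2 i pi t)]. *)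
Definition phase (z : C) : R :=
  xget 0 [set t : R | 0 <= t < 1 /\ expi2pi t = z]%classic.

Definition chargeR A (i : 'I_N) : R := ratr (charge A i 0).

Implicit Types (h : 'I_N -> C).

Definition weight A h (m : 'X_{1..#|fix_set h|}) : R :=
  \sum_j (m j)%:R * chargeR A (enum_val j).

Definition QA_plus A h : R :=
  \sum_(i | phase (h i) != 0) (phase (h i) - chargeR A i).
Definition QA_minus A h : R :=
  \sum_(i | phase (h i) != 0) (phase (h i) - chargeR A i)
  + \sum_(i | phase (h i) == 0) (1 - 2 * chargeR A i).
Definition QB_plus A h : R :=
  \sum_(i | phase (h i) != 0) (phase (h i) - chargeR A i).
Definition QB_minus A h : R :=
  \sum_(i | phase (h i) != 0) (1 - phase (h i) - chargeR A i).

Definition bidegA A h (m : 'X_{1..#|fix_set h|}) : R * R :=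
  (QA_plus A h + weight A m, QA_minus A h - weight A m).
Definition bidegB A h (m : 'X_{1..#|fix_set h|}) : R * R :=
  (QB_plus A h + weight A m, QB_minus A h + weight A m).

Definition has_bidegree (V : {mpoly C[N]}) (K : set ('I_N -> C))
    (bideg : forall h, 'X_{1..#|fix_set h|} -> R * R) (d : R * R)
    (x : state_space V K) : Prop :=
  forall h, exists2 p, milnor_class (restrict_to (fix_set h) V) p = val x h
                     & forall m, m \in msupp p -> bideg h m = d.

(* The two state spaces of a pair are the same vector space; only their
   bi-gradings differ. *)
Definition A_model A (G : set ('I_N -> C)) := state_space (potential A) G.
Definition B_model A (G : set ('I_N -> C)) := state_space (potential A) G.

HB.instance Definition _ A G := GRing.Lmodule.on (A_model A G).
HB.instance Definition _ A G := GRing.Lmodule.on (B_model A G).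

Definition A_bidegree A G (d : R * R) (x : A_model A G) : Prop :=
  has_bidegree (@bidegA A) d x.
Definition B_bidegree A G (d : R * R) (x : B_model A G) : Prop :=
  has_bidegree (@bidegB A) d x.

End InvertiblePotential.

(* Main.v *)
Require Import Defs.
From HB Require Import structures.
From mathcomp Require Import all_boot all_order all_algebra all_fingroup.
From mathcomp Require Import ssrcomplements mpoly complex.
From mathcomp Require Import boolp classical_sets cardinality reals trigo exp.
From mathcomp Require Import ring lra zify.

(** The isolated critical point and the bound on the exponents force the normal
    form of Kreuzer and Skarke ([kreuzer_skarke]): every variable [x_i] can be
    matched with a monomial [y_i = x_i ^ a_i * x_(k i)], where [k] is a partial
    injection without fixed points ([y_i = x_i ^ a_i] when [k i] is undefined).
    Loops, chains and Fermat terms are the orbits of [k].  The proof works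
    directly with [k] and its partial inverse [p], so that all types of
    potentials, and their sums, are treated at once, and transposition merely
    reverses the arrows.

    A form [x ^ m dx] is written [y ^ t dx / x], where [t] is the rational vector
    with [t B = m + 1], for the exponent matrix [B] of the [y_i].  Modulo the Jacobian ideal,
      [a_j y ^ (t + e_j) + y ^ (t + e_(p j)) = 0],
    so the sum of [t], which is the weight up to a constant, and the class of [t]
    modulo integral vectors, which is the character, are both preserved.  The Milnor ring
    has a basis of good monomials: those with [t] in the unit cube, where zeros
    and ones alternate along the arrows ([good]).  They span, because every
    monomial can be moved into the unit cube or lies in the ideal ([red_good]).
    They are independent, because of an explicit functional for each of them: the integral
    of [y ^ s dx / x] against [exp V] is a product of Gamma values at the entries
    of [s], and its part of lowest weight kills the Jacobian ideal
    ([good_coef_rel]).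

    Applied to every fixed locus, this gives a basis of the direct sum of all the
    sectors.  It is indexed by pairs of vectors [u], [w] in the unit cube: the
    sector is [exp (2 i pi u)], the form has exponent vector [w], and exactly one
    of [u_j], [w_j] vanishes for every [j].  On the coordinates fixed by the
    sector [u_j] is determined up to an integer only; choosing it to be [1]
    exactly where [w_j = 0] turns the alternation condition into a matching
    between the ones of [w] and the ones of [u] along the arrows
    ([mirror_pair]).  In this shape the conditions on [u] and [w] are symmetric,
    and exchanging them is the mirror map to the transposed potential
    ([is_mirror_swap]).

    The form with exponent vector [w] is invariant under [G] exactly when
    [exp (2 i pi w)] lies in the dual group, and the sector [exp (2 i pi u)] lies
    in [G] exactly when the dual form is invariant under the dual group; the
    latter is double duality for lattices ([mem_dual], [mem_double_dual]).
    Finally both bidegrees are sums over the entries of [u] and [w] which agree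
    because the matching makes the ones of [u] and [w] equinumerous
    ([bideg_swap]). *)

Set Implicit Arguments.
Unset Strict Implicit.
Unset Printing Implicit Defensive.
Import Order.TTheory GRing.Theory Num.Theory.
Local Open Scope ring_scope.

(** * Arrows and exponents *)

(** The combinatorial type of an invertible polynomial: the monomial attached to
    [i] is [x_i ^ a_i * x_(k i)], and [p] is the partial inverse of [k].  The
    inverse is kept as data because transposition exchanges [k] and [p]. *)
Record arrows (n : nat) (a : 'I_n -> nat) (k p : 'I_n -> option 'I_n) : Prop :=
  Arrows {
    arrows_ge2 : forall i, (2 <= a i)%N;
    arrows_kp : forall i j, (k i == Some j) = (p j == Some i);
    arrows_irr : forall i, k i != Some i }.

Lemma arrows_rev n (a : 'I_n -> nat) k p : arrows a k p -> arrows a p k.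
Proof.
case=> a2 kp irr; split; [exact: a2|by move=> i j; rewrite kp|].
by move=> i; rewrite -kp.
Qed.

Section Neighbours.
Variables (n : nat) (a : 'I_n -> nat) (k p : 'I_n -> option 'I_n).
Hypothesis S : arrows a k p.

Lemma arrows_next i j : p j = Some i -> k i = Some j.
Proof. by move=> e; apply/eqP; rewrite (arrows_kp S) e. Qed.

Lemma arrows_prev i j : k i = Some j -> p j = Some i.
Proof. by move=> e; apply/eqP; rewrite -(arrows_kp S) e. Qed.

Lemma arrows_prev_neq i j : p j = Some i -> i != j.
Proof.
move/arrows_next => e; apply/eqP => ij.
by have := arrows_irr S i; rewrite e ij eqxx.
Qed.
End Neighbours.

(** The product [t B] of a row vector with the exponent matrix of the arrows:
    the exponents of the monomial [y ^ t], where [y_i = x_i ^ a_i * x_(k i)]. *)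
Definition rowexp n (a : 'I_n -> nat) (p : 'I_n -> option 'I_n)
  (t : 'I_n -> rat) (j : 'I_n) : rat := (a j)%:R * t j + oapp t 0 (p j).

Definition arrow_mx n (a : 'I_n -> nat) (k : 'I_n -> option 'I_n) : 'M[rat]_n :=
  \matrix_(i, j) ((a i)%:R *+ (i == j) + (k i == Some j)%:R).

(** An entry of maximal absolute value satisfies [a_j |t_j| = |t_(p j)| <= |t_j|]
    with [a_j >= 2]. *)
Lemma diag_dominant (K : realFieldType) n (a : 'I_n -> nat)
    (p : 'I_n -> option 'I_n) (t : 'I_n -> K) : (forall i, (2 <= a i)%N) ->
  (forall j, (a j)%:R * t j + oapp t 0 (p j) = 0) -> forall j, t j = 0.
Proof.
move=> a2 t0 j0; pose j := [arg max_(j > j0) `|t j|]%O.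
have maxj i : `|t i| <= `|t j|.
  by rewrite /j; case: arg_maxP => // l _; apply.
suff : `|t j| <= 0.
  by move=> tj; apply/eqP; rewrite -normr_le0 (le_trans (maxj _)).
have e : (a j)%:R * t j = - oapp t 0 (p j) by have := t0 j; lra.
have {e} := congr1 Num.norm e; rewrite normrM normrN ger0_norm // => e.
have : `|oapp t 0 (p j)| <= `|t j| by case: (p j) => [i|] //=; rewrite normr0.
have : (2 : K) <= (a j)%:R by rewrite (ler_nat _ 2).
by have := normr_ge0 (t j); rewrite -e; nra.
Qed.

Section Exponents.
Variables (n : nat) (a : 'I_n -> nat) (k p : 'I_n -> option 'I_n).
Hypothesis S : arrows a k p.
Local Notation rowexp := (rowexp a p).
Local Notation B := (arrow_mx a k).
Implicit Types (t s : 'I_n -> rat) (m : 'X_{1..n}).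

Let a2 i : (2 : rat) <= (a i)%:R.
Proof. by rewrite (ler_nat _ 2); case: S => /(_ i). Qed.

Lemma sum_pre (R : nmodType) (f : 'I_n -> R) (o : option 'I_n) :
  \sum_(i | o == Some i) f i = oapp f 0 o.
Proof.
case: o => [i|] /=; last by rewrite big_pred0.
by rewrite (big_pred1 i) // => j; rewrite /= eq_sym.
Qed.

Lemma mulmx_arrow t : (\row_i t i) *m B = \row_j rowexp t j.
Proof.
apply/rowP=> j; rewrite !mxE /rowexp -sum_pre [X in _ = _ + X]big_mkcond /=.
rewrite [X in X + _](_ : _ = \sum_i if i == j then (a i)%:R * t i else 0).
  rewrite -big_split /=; apply: eq_bigr => i _; rewrite !mxE (arrows_kp S).
  by case: (i == j); case: (p j == Some i) => /=; ring.
by rewrite -big_mkcond big_pred1_eq.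
Qed.

Lemma rowexp_eq0 t : (forall j, rowexp t j = 0) -> forall j, t j = 0.
Proof. exact: diag_dominant (arrows_ge2 S). Qed.

Lemma arrow_mx_unit : B \in unitmx.
Proof.
rewrite -row_free_unit -kermx_eq0; apply/rowV0P => v /sub_kermxP vB.
have ev : v = \row_i v 0 i by apply/rowP => i; rewrite mxE.
apply/rowP => i; rewrite mxE; apply: (rowexp_eq0 (t := v 0)) => j.
by have := mulmx_arrow (v 0); rewrite -ev vB => /rowP /(_ j); rewrite !mxE.
Qed.

Lemma rowexpB t s j : rowexp (fun i => t i - s i) j = rowexp t j - rowexp s j.
Proof. by rewrite /rowexp; case: (p j) => [i|] /=; ring. Qed.

Lemma rowexpD t s j : rowexp (fun i => t i + s i) j = rowexp t j + rowexp s j.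
Proof. by rewrite /rowexp; case: (p j) => [i|] /=; ring. Qed.

Lemma rowexp_inj t s : (forall j, rowexp t j = rowexp s j) -> t = s.
Proof.
move=> ts; apply/funext => j; apply/eqP; rewrite -subr_eq0; apply/eqP.
by apply: (rowexp_eq0 (t := fun i => t i - s i)) => {}j; rewrite rowexpB ts subrr.
Qed.

(** The vector [t] such that [x ^ m dx = y ^ t dx / x]; the shift of the exponents
    by one accounts for the volume form. *)
Definition tau_of m : 'I_n -> rat :=
  fun i => ((\row_j (m j).+1%:R) *m invmx B) 0 i.

Lemma rowexp_tau_of m j : rowexp (tau_of m) j = (m j).+1%:R.
Proof.
have := mulmx_arrow (tau_of m).
rewrite (_ : \row_i tau_of m i = (\row_j (m j).+1%:R) *m invmx B); last first.
  by apply/rowP => i; rewrite mxE.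
by rewrite mulmxKV ?arrow_mx_unit // => /rowP /(_ j); rewrite !mxE.
Qed.

Lemma tau_ofE t m : (forall j, rowexp t j = (m j).+1%:R) -> tau_of m = t.
Proof. by move=> e; apply: rowexp_inj => j; rewrite rowexp_tau_of e. Qed.

Definition unitv (j : 'I_n) : 'I_n -> rat := fun i => (i == j)%:R.

Lemma rowexp_unit j l :
  rowexp (unitv j) l = (a j)%:R * (l == j)%:R + (k j == Some l)%:R.
Proof.
rewrite /rowexp /unitv (arrows_kp S); congr (_ + _).
  by case: eqP => [->|] //=; rewrite !mulr0.
by case: (p l) => [i|] //=; case: eqVneq => [->|ij]; rewrite ?eqxx // eq_sym;
   case: eqP => // -[] e; rewrite e eqxx in ij.
Qed.

(** * Good exponent vectors *)

(** In a chain the zeros and ones of a good vector form an initial segment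
    [1, 0, 1, 0, ..., 1, 0]; in a loop there are none, or they fill an even loop
    alternately, in one of two ways. *)
Record good t : Prop := Good {
  good01 : forall i, 0 <= t i <= 1;
  good0 : forall j, t j = 0 -> exists2 i, p j = Some i & t i = 1;
  good1 : forall j, t j = 1 -> exists2 i, k j = Some i & t i = 0;
  goodZ : forall j, rowexp t j \is a Num.int }.

Lemma good1p t i j : good t -> t j = 1 -> p j = Some i -> t i = 0.
Proof.
move=> gt tj pj; have := goodZ gt j; rewrite /rowexp pj tj /= mulr1 => ri.
have ti : t i \is a Num.int.
  by rewrite -[t i](addKr (a j)%:R) addrC rpredB // rpred_nat.
have kij := arrows_next S pj.
have := good01 gt i; case/intrP: ti => z tz; rewrite tz => z01.
have : (z == 0) || (z == 1) by move: z01; rewrite (ler_int _ 0) (ler_int _ _ 1); lia.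
case/orP=> /eqP ez; first by rewrite ez.
by have [|l] := good1 gt (j := i); rewrite ?tz ?ez // kij => -[<-]; rewrite tj.
Qed.

Lemma good_rowexp_ge1 t j : good t -> 1 <= rowexp t j.
Proof.
move=> gt; have : 0 < rowexp t j.
  have := good01 gt j; rewrite /rowexp; have := a2 j.
  have : 0 <= oapp t 0 (p j) by case: (p j) => [i|] //=; have := good01 gt i; lra.
  have [tj|] := eqVneq (t j) 0; last by move=> /eqP; nra.
  by have [i -> ti] := good0 gt tj; rewrite /= tj ti; lra.
by have /intrP [z ->] := goodZ gt j; rewrite (ltr_int _ 0) (ler_int _ 1).
Qed.

Lemma sum_pre_le (f : 'I_n -> rat) : (forall i, 0 <= f i) ->
  \sum_j oapp f 0 (p j) <= \sum_i f i.
Proof.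
move=> f0; under eq_bigr => j _ do rewrite -sum_pre.
rewrite (exchange_big_dep predT) //=; apply: ler_sum => i _.
under eq_bigl => j do rewrite -(arrows_kp S).
by rewrite (sum_pre (fun=> f i)); case: (k i).
Qed.

Lemma int_ge (x y : rat) : x - y \is a Num.int -> x > y - 1 -> x >= y.
Proof.
case/intrP=> z e lt; have : (-1 : rat) < z%:~R by rewrite -e; lra.
rewrite (ltr_int _ (-1)) => z1; have : (0 : rat) <= z%:~R by rewrite (ler_int _ 0); lia.
by rewrite -e; lra.
Qed.

(** Among the monomials with a given character, the good ones have minimal
    weight: a drop of [n] at [j] makes the exponent of [x_j] positive only if it
    is compensated by a rise of at least [n] at [p j], and [p] is injective. *)
Lemma good_min t s : good t -> (forall i, s i - t i \is a Num.int) ->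
  (forall j, 1 <= rowexp s j) -> 0 <= \sum_i (s i - t i).
Proof.
move=> gt st s1.
have [d dE] : {d | d =1 fun i => s i - t i} by exists (fun i => s i - t i).
have dZ i : d i \is a Num.int by rewrite dE.
under eq_bigr => i _ do rewrite -dE.
have key j : Num.max (- d j) 0 <= oapp (fun i => Num.max (d i) 0) 0 (p j).
  have [dj|dj] := lerP 0 (d j).
    by rewrite max_r ?oppr_le0 //; case: (p j) => [i|] //=; rewrite le_max lexx orbT.
  rewrite max_l; last by lra.
  have dj1 : 1 <= - d j.
    by apply: int_ge; [rewrite rpredB ?rpredN ?dZ // rpred1|lra].
  have /andP [tj0 tj1] := good01 gt j; have aj := a2 j.
  have ad : 0 <= ((a j)%:R - 2) * (- d j - t j) by apply: mulr_ge0; lra.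
  have := s1 j; rewrite /rowexp (_ : s j = t j + d j); last by rewrite dE; ring.
  case pj : (p j) => [i|] /=; last by nra.
  move=> si; rewrite le_max; apply/orP; left.
  have /andP [ti0 ti1] := good01 gt i.
  apply: int_ge; first by rewrite opprK rpredD ?dZ.
  have [tj|/eqP tj] := eqVneq (t j) 1.
    by have := good1p gt tj pj; rewrite (dE i); nra.
  have tjlt : t j < 1 by rewrite lt_neqAle tj1 andbT; apply/eqP.
  by rewrite (dE i); nra.
have -> : \sum_i d i =
    \sum_i Num.max (d i) 0 - \sum_i Num.max (- d i) 0.
  rewrite -sumrB; apply: eq_bigr => i _.
  have [di|di] := lerP 0 (d i).
    by rewrite max_r ?subr0 // oppr_le0.
  by rewrite max_l ?sub0r ?opprK // oppr_ge0 ltW.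
rewrite subr_ge0 (le_trans (ler_sum _ (fun j _ => key j))) //.
by apply: sum_pre_le => i; rewrite le_max lexx orbT.
Qed.

(** * Independence of the good monomials *)

(** This is [(-1) ^ z * Gamma (x + z) / Gamma x]. *)
Definition gamma_ratio (x : rat) (z : int) : rat :=
  match z with
  | Posz e => \prod_(i < e) - (x + i%:R)
  | Negz e => \prod_(i < e.+1) (- (x - i.+1%:R))^-1
  end.

Lemma gamma_ratioS x z : x \isn't a Num.int ->
  gamma_ratio x (z + 1) = - (x + z%:~R) * gamma_ratio x z.
Proof.
move=> xZ; have x0 e : - (x - e%:R) != 0.
  by rewrite oppr_eq0 subr_eq0; apply: contra xZ => /eqP ->; exact: rpred_nat.
case: z => [e|[|e]].
- have -> : Posz e + 1 = Posz e.+1 by lia.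
  by rewrite /= big_ord_recr /= mulrC.
- have -> : Negz 0 + 1 = 0 :> int by lia.
  rewrite /= big_ord0 big_ord_recr big_ord0 /= mul1r NegzE.
  by rewrite mulfV ?(x0 1%N).
- have -> : Negz e.+1 + 1 = Negz e by rewrite !NegzE; lia.
  rewrite /= [in RHS]big_ord_recr /= mulrCA NegzE.
  by rewrite (_ : (- e.+2%:Z)%:~R = - e.+2%:R :> rat) ?mulfV ?mulr1 ?(x0 e.+2) // mulrNz.
Qed.

Definition is01 (x : rat) := (x == 0) || (x == 1).

(** At an integer [x] the quotient of Gamma values has poles or zeros, and is
    replaced by the indicator of [d = 0]: minimality of the weight forces the
    integral entries to agree with those of a good vector. *)
Definition gamma_factor (x d : rat) : rat :=
  if is01 x then (d == 0)%:R else gamma_ratio x (Num.floor d).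

Lemma gamma_factorS x d : ~~ is01 x -> 0 <= x <= 1 -> d \is a Num.int ->
  gamma_factor x (d + 1) = - (x + d) * gamma_factor x d.
Proof.
move=> nb x01 /intrP [z ->]; rewrite /gamma_factor (negPf nb).
rewrite (_ : z%:~R + 1 = (z + 1)%:~R); last by rewrite intrD.
rewrite !intrKfloor gamma_ratioS //; apply: contra nb => /intrP [y ey].
have : (y == 0) || (y == 1) by move: x01; rewrite ey (ler_int _ 0) (ler_int _ _ 1); lia.
by rewrite ey /is01; case/orP => /eqP ->.
Qed.

(** The coefficient of the good monomial [y ^ t] in the class of [y ^ s]. *)
Definition good_coef t s : rat :=
  if [forall i, (s i - t i) \is a Num.int] && (\sum_i (s i - t i) == 0)
  then \prod_i gamma_factor (t i) (s i - t i) else 0.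

Lemma good_coef_id t : good_coef t t = 1.
Proof.
rewrite /good_coef; case: ifPn => [_|/negP []].
  by rewrite big1 // => i _; rewrite subrr /gamma_factor eqxx floor0;
     case: ifP => //= _; rewrite big_ord0.
apply/andP; split; first by apply/forallP => i; rewrite subrr rpred0.
by rewrite big1 // => i _; rewrite subrr.
Qed.

Lemma good_coef_good t s : good t -> good s -> good_coef t s != 0 -> s = t.
Proof.
move=> gt gs; rewrite /good_coef; case: ifP; last by rewrite eqxx.
case/andP=> /forallP st _; move/prodf_neq0 => nz; apply/funext => i.
have := nz i isT; rewrite /gamma_factor; case: ifP => [_|/negbT nb].
  by rewrite pnatr_eq0 eqb0 negbK subr_eq0 => /eqP.
move=> _; have := st i; have := good01 gs i; have := good01 gt i.
move: nb; rewrite negb_or => /andP [/eqP t0 /eqP t1] ti si /intrP [z ez].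
have ti' : 0 < t i < 1.
  move: ti => /andP [ti0 ti1]; rewrite !lt_neqAle ti0 ti1 !andbT eq_sym.
  by apply/andP; split; apply/eqP.
case/andP: ti' si => ti0 ti1 /andP [si0 si1].
have : (-1 : rat) < z%:~R by rewrite -ez; lra.
have : (z%:~R : rat) < 1 by rewrite -ez; lra.
rewrite (ltr_int _ (-1)) (ltr_int _ _ 1) => z1 z0.
by move: ez; rewrite (_ : z = 0) ?mulr0z; [lra|lia].
Qed.

(** The relations of the Jacobian ideal are killed.  If both monomials have the
    weight of [t], then [s] lies below the minimal weight, so [good_min] forbids
    all its exponents to be positive and the one at [j] vanishes:
    [a_j s_j + s_(p j) = 0].  Away from the integral entries of [t] this is the
    required identity, by the functional equation of Gamma.  At an integral
    entry both terms vanish, since otherwise the exponent at [j] would not vanish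
    or one next to it would not be positive. *)
Lemma good_coef_rel t s j : good t ->
    (forall l, l != j -> 1 <= rowexp s l) -> 0 <= rowexp s j ->
    rowexp s j \is a Num.int ->
  (a j)%:R * good_coef t (fun i => s i + unitv j i)
    + oapp (fun l => good_coef t (fun i => s i + unitv l i)) 0 (p j) = 0.
Proof.
move=> gt s1 sj sjZ.
have condE l : [forall i, (s i + unitv l i - t i) \is a Num.int]
    && (\sum_i (s i + unitv l i - t i) == 0)
  = [forall i, (s i - t i) \is a Num.int] && (\sum_i (s i - t i) == -1).
  congr andb.
    apply: eq_forallb => i; rewrite addrAC; apply: rpredDr.
    exact: rpred_nat.
  under eq_bigr => i _ do rewrite addrAC.
  rewrite big_split /= (_ : \sum_i unitv l i = 1) ?addr_eq0 //.
  rewrite (bigD1 l) //= {1}/unitv eqxx big1 ?addr0 // => i /negPf il.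
  by rewrite /unitv il.
have phiE l : good_coef t (fun i => s i + unitv l i) =
    if [forall i, (s i - t i) \is a Num.int] && (\sum_i (s i - t i) == -1)
    then \prod_i gamma_factor (t i) (s i + unitv l i - t i) else 0.
  by rewrite /good_coef condE.
case: (boolP ([forall i, (s i - t i) \is a Num.int]
              && (\sum_i (s i - t i) == -1))) => [|nC]; last first.
  rewrite phiE (negPf nC) mulr0 add0r.
  by case: (p j) => [l|] //=; rewrite phiE (negPf nC).
case/andP=> /forallP sZ sum1.
have {}phiE l : good_coef t (fun i => s i + unitv l i) =
    \prod_i gamma_factor (t i) (s i + unitv l i - t i).
  by rewrite phiE sum1 andbT; case: forallP.
have -> : oapp (fun l => good_coef t (fun i => s i + unitv l i)) 0 (p j) =
    oapp (fun l => \prod_i gamma_factor (t i) (s i + unitv l i - t i)) 0 (p j).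
  by case: (p j) => //= l; rewrite phiE.
rewrite phiE; move: sum1 => /eqP sum1.
have {condE phiE} rj : (a j)%:R * s j + oapp s 0 (p j) = 0.
  apply/eqP; rewrite -[X in X == 0]/(rowexp s j); apply/negP => /negP nz.
  have : 0 <= \sum_i (s i - t i); last by rewrite sum1; lra.
  apply: good_min => // l; have [->|/s1 //] := eqVneq l j.
  case/intrP: sjZ sj nz => z ->; rewrite (ler_int _ 0) (ler_int _ 1) intr_eq0; lia.
have bndZ i : t i \is a Num.int -> is01 (t i).
  have := good01 gt i => ti /intrP [z ez]; move: ti; rewrite ez (ler_int _ 0).
  rewrite (ler_int _ _ 1) => z01; have : (z == 0) || (z == 1) by lia.
  by rewrite /is01; case/orP => /eqP ->.
have prod0 l : \prod_i gamma_factor (t i) (s i + unitv l i - t i) != 0 ->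
    forall i, is01 (t i) -> s i + unitv l i = t i.
  move/prodf_neq0 => nz i bi; have := nz i isT; rewrite /gamma_factor bi.
  by rewrite pnatr_eq0 eqb0 negbK subr_eq0 => /eqP.
have prodS l : ~~ is01 (t l) -> \prod_i gamma_factor (t i) (s i + unitv l i - t i) =
    - s l * \prod_i gamma_factor (t i) (s i - t i).
  move=> nb; rewrite (bigD1 l) //= [in RHS](bigD1 l) //= mulrA; congr (_ * _).
    rewrite /unitv eqxx (_ : s l + 1 - t l = s l - t l + 1); last by ring.
    by rewrite gamma_factorS ?(good01 gt) //; congr (- _ * _); ring.
  by apply: eq_bigr => i /negPf il; rewrite /unitv il addr0.
have eij (l i : 'I_n) : i != l -> unitv l i = 0 by rewrite /unitv => /negPf ->.
have eii (l : 'I_n) : unitv l l = 1 by rewrite /unitv eqxx.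
have pk i l : p i = Some l -> k l = Some i by exact: (arrows_next S).
have kp i l : k l = Some i -> p i = Some l by exact: (arrows_prev S).
have pirr i l : p i = Some l -> l != i by exact: (arrows_prev_neq S).
have b0 i : t i = 0 -> is01 (t i) by move->.
have b1 i : t i = 1 -> is01 (t i) by move->.
have aj := a2 j.
case bj : (is01 (t j)).
  case/orP: bj => /eqP tj.
    have [i pj ti] := good0 gt tj; rewrite pj /= in rj *.
    have ij := pirr _ _ pj.
    have -> : \prod_i gamma_factor (t i) (s i + unitv j i - t i) = 0.
      apply/eqP; apply: contraT => /prod0 nz.
      have := nz j (b0 _ tj); have := nz i (b1 _ ti).
      by rewrite eii eij // tj ti; nra.
    rewrite mulr0 add0r; apply/eqP; apply: contraT => /prod0 nz.
    have := nz i (b1 _ ti); rewrite eii ti => si.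
    have si0 : s i = 0 by lra.
    have := s1 i ij; rewrite /rowexp si0 mulr0 add0r.
    case pi : (p i) => [l|] //=; have tl := good1p gt ti pi.
    by have := nz l (b0 _ tl); rewrite eij ?(pirr _ _ pi) // tl; lra.
  have [l kj tl] := good1 gt tj; have pl := kp _ _ kj.
  have lj : l != j by rewrite eq_sym (pirr _ _ pl).
  have -> : \prod_i gamma_factor (t i) (s i + unitv j i - t i) = 0.
    apply/eqP; apply: contraT => /prod0 nz.
    have := nz j (b1 _ tj); have := nz l (b0 _ tl).
    have := s1 l lj; rewrite /rowexp pl /= eii eij // tj tl.
    by move=> h1 h2 h3; have := a2 l; nra.
  rewrite mulr0 add0r; case pj : (p j) rj => [i|] //= rj.
  apply/eqP; apply: contraT => /prod0 nz; have ti := good1p gt tj pj.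
  have := nz i (b0 _ ti); have := nz j (b1 _ tj).
  by rewrite eii eij ?(eq_sym j) ?(pirr _ _ pj) // tj ti; nra.
move/negbT: (bj) => nbj; rewrite prodS //.
case pj : (p j) rj => [i|] /= rj; last first.
  by rewrite addr0 mulrA mulrN -(addr0 (_ * s j)) rj oppr0 mul0r.
have [bi|nbi] := boolP (is01 (t i)); last first.
  by rewrite prodS // mulrA -mulrDl mulrN -opprD rj oppr0 mul0r.
have ij := pirr _ _ pj.
have ti : t i = 0.
  case/orP: bi => /eqP // ti; have [l] := good1 gt ti.
  by rewrite (pk _ _ pj) => -[<-] tj; rewrite tj in bj.
have [l pi tl] := good0 gt ti.
rewrite -prodS //.
have -> : \prod_i gamma_factor (t i) (s i + unitv j i - t i) = 0.
  apply/eqP; apply: contraT => /prod0 nz; have := nz i bi.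
  rewrite eij // ti addr0 => si; rewrite si addr0 in rj.
  have sj0 : s j = 0 by nra.
  by have := sZ j; rewrite sj0 sub0r rpredN => /bndZ; rewrite bj.
rewrite mulr0 add0r; apply/eqP; apply: contraT => /prod0 nz.
have := nz i bi; have := nz l (b1 _ tl); have := s1 i ij.
rewrite /rowexp pi /= eii eij ?(pirr _ _ pi) // ti tl.
by move=> h1 h2 h3; have := a2 i; nra.
Qed.
End Exponents.

(** Following the relations [v x = c *: v y] from any [x] leads to a zero vector or
    into a cycle, where a vector equals itself times a scalar different from [1]. *)
Lemma contraction_eq0 (F : numFieldType) (U : lmodType F) (T : eqType)
    (v : T -> U) (s : seq T) :
  {in s, forall x, exists2 y, y \in s \/ v y = 0 &
     exists2 c : F, `|c| < 1 & v x = c *: v y} ->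
  {in s, forall x, v x = 0}.
Proof.
elim: s => [|x s IH] H //.
have [y ys [c c1 vx]] := H x (mem_head _ _).
have [yx|yx] := eqVneq y x.
  have vx0 : v x = 0.
    have /eqP : (1 - c) *: v x = 0.
      by rewrite scalerBl scale1r {1}vx yx subrr.
    rewrite scaler_eq0 => /orP[|/eqP //]; rewrite subr_eq0 => /eqP c1'.
    by rewrite -c1' normr1 ltxx in c1.
  have Hs : {in s, forall z, v z = 0}.
    apply: IH => z zs; have [|y' ys' E] := H z; first by rewrite inE zs orbT.
    exists y' => //; case: ys'; last by right.
    by rewrite inE => /orP[/eqP->|]; [right|left].
  by move=> z; rewrite inE => /orP[/eqP ->|/Hs].
have {}ys : y \in s \/ v y = 0 by case: ys; rewrite ?inE ?(negPf yx); auto.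
have Hs : {in s, forall z, v z = 0}.
  apply: IH => z zs; have [|y' ys' [c' c1' vz]] := H z.
    by rewrite inE zs orbT.
  have [y'x|y'x] := eqVneq y' x.
    exists y => //; exists (c' * c); last by rewrite -scalerA -vx -y'x.
    rewrite normrM; apply: le_lt_trans c1'; rewrite -[leRHS]mulr1.
    by rewrite ler_wpM2l // ltW.
  exists y'; first by case: ys'; rewrite ?inE ?(negPf y'x); auto.
  by exists c'.
move=> z; rewrite inE => /orP[/eqP ->|/Hs //].
by rewrite vx; case: ys => [/Hs|] ->; rewrite scaler0.
Qed.

(** * The good monomials span the Milnor ring *)

Definition mono n (a : 'I_n -> nat) (k : 'I_n -> option 'I_n) i : 'X_{1..n} :=
  (U_(i) *+ a i + oapp (fun j => U_(j)) 0 (k i))%MM.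

Definition arrow_pot (F : fieldType) n (a : 'I_n -> nat)
    (k : 'I_n -> option 'I_n) : {mpoly F[n]} :=
  \sum_i 'X_[mono a k i].

Section Spanning.
Variables (F : numFieldType) (n : nat).
Variables (a : 'I_n -> nat) (k p : 'I_n -> option 'I_n).
Hypothesis S : arrows a k p.
Local Notation rowexp := (rowexp a p).
Local Notation B := (arrow_mx a k).
Local Notation V := (arrow_pot F a k).
Local Notation mono := (mono a k).
Local Notation tau_of := (tau_of a k).
Implicit Types (t s : 'I_n -> rat) (m : 'X_{1..n}).

Let a2 i : (2 : rat) <= (a i)%:R.
Proof. by rewrite (ler_nat _ 2); case: S => /(_ i). Qed.

Definition cls m : milnor V := milnor_class V 'X_[m].

(** The exponents of [y_j / x_j], for the monomial [y_j] of [j]. *)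
Definition premono j : 'X_{1..n} :=
  (U_(j) *+ (a j).-1 + oapp (fun i => U_(i)) 0 (k j))%MM.

Lemma monoE i l : mono i l = (a i * (i == l) + (k i == Some l))%N.
Proof.
rewrite mnmDE mulmnE mnm1E mulnC; congr (_ + _)%N.
by case: (k i) => [j|] /=; rewrite ?mnm1E ?mnm0E.
Qed.

Lemma mono_premono j : mono j = (premono j + U_(j))%MM.
Proof.
rewrite /mono /premono -{1}(prednK (ltnW (arrows_ge2 S j))) mulmSr -!addmA.
by congr (_ + _)%MM; rewrite addmC.
Qed.

Let pk i j : p j = Some i -> k i = Some j := @arrows_next _ _ _ _ S i j.
Let kp i j : k i = Some j -> p j = Some i := @arrows_prev _ _ _ _ S i j.
Let pirr i j : p j = Some i -> i != j := @arrows_prev_neq _ _ _ _ S i j.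

Lemma deriv_pot j : V^`M(j) =
  (a j)%:R *: 'X_[premono j] + oapp (fun i => 'X_[U_(i) *+ a i]) 0 (p j).
Proof.
rewrite linear_sum /= -[X in _ = _ + X](sum_pre (fun i => 'X_[U_(i) *+ a i])).
rewrite (bigD1 j) //= mderivX mono_premono addmK -mono_premono monoE eqxx muln1.
rewrite (negPf (arrows_irr S j)) addn0; congr (_ + _).
rewrite big_mkcond [RHS]big_mkcond /=; apply: eq_bigr => i _.
rewrite mderivX monoE (arrows_kp S).
have [->|ij] := eqVneq i j.
  by rewrite -(arrows_kp S) (negPf (arrows_irr S j)).
rewrite muln0 add0n; case: eqP => [/pk kij|_]; last by rewrite scale0r.
by rewrite scale1r /mono kij /= addmK.
Qed.

Lemma jacobian_gen (f : {mpoly F[n]}) j : f * V^`M(j) \in jacobian V.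
Proof.
apply/asboolP; exists (fun i => if i == j then f else 0).
rewrite (bigD1 j) //= eqxx big1 ?addr0 // => i /negPf ->.
by rewrite mul0r.
Qed.

Lemma cls_eq0 f : milnor_class V f = 0 <-> f \in jacobian V.
Proof.
have c0 : milnor_class V 0 = 0 by exact: raddf0.
by rewrite -c0; split=> [/milnor_classP|fJ]; [|apply/milnor_classP];
   rewrite subr0.
Qed.

Lemma cls_rel m j : (a j)%:R *: cls (m + premono j)
  + oapp (fun i => cls (m + U_(i) *+ a i)) 0 (p j) = 0.
Proof.
have c0 : milnor_class V 0 = 0 by exact: raddf0.
have := jacobian_gen 'X_[m] j; rewrite deriv_pot => /cls_eq0 E.
rewrite -[RHS]E.
rewrite mulrDr milnor_classD -scalerAr milnor_classZ -mpolyXD; congr (_ + _).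
by case: (p j) => [i|] /=; rewrite ?mulr0 ?c0 -?mpolyXD.
Qed.

(** The Euler derivatives [x_j dV / dx_j] are combinations of the monomials [y_i]
    with an invertible matrix of coefficients, so each [y_i] lies in the ideal. *)
Lemma cls_mono m i : cls (m + mono i) = 0.
Proof.
have euler j : \sum_i (mono i j)%:R *: cls (m + mono i) = 0.
  rewrite -[RHS](cls_rel (m + U_(j))%MM j).
  rewrite -(sum_pre (fun i => cls (m + U_(j) + U_(i) *+ a i))).
  rewrite (bigD1 j) //= monoE eqxx muln1 (negPf (arrows_irr S j)) addn0.
  rewrite {1}mono_premono (addmC (premono j)) addmA; congr (_ + _).
  rewrite big_mkcond [RHS]big_mkcond /=; apply: eq_bigr => l _.
  rewrite monoE (arrows_kp S); have [->|lj] := eqVneq l j.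
    by rewrite -(arrows_kp S) (negPf (arrows_irr S j)).
  rewrite muln0 add0n; case: eqP => [/pk klj|_]; last by rewrite scale0r.
  by rewrite scale1r /mono klj /= -!addmA (addmC U_(j)%MM).
pose C := invmx B.
have BC l : \sum_j (mono l j)%:R * C j i = (l == i)%:R.
  have := congr1 (fun M : 'M[rat]_n => M l i) (mulmxV (arrow_mx_unit S)).
  rewrite !mxE => <-; apply: eq_bigr => j _; congr (_ * _).
  by rewrite mxE monoE natrD natrM mulr_natr.
have : \sum_j ratr (C j i) *: (\sum_l (mono l j)%:R *: cls (m + mono l)) = 0.
  by rewrite big1 // => j _; rewrite euler scaler0.
under eq_bigr => j _ do rewrite scaler_sumr.
rewrite exchange_big /= (bigD1 i) //= [X in _ + X]big1 ?addr0 => [|l li]; last first.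
  under eq_bigr => j _ do rewrite scalerA -(ratr_nat F) -rmorphM mulrC.
  by rewrite -scaler_suml -rmorph_sum BC (negPf li) rmorph0 scale0r.
under eq_bigr => j _ do rewrite scalerA -(ratr_nat F) -rmorphM mulrC.
by rewrite -scaler_suml -rmorph_sum BC eqxx rmorph1 scale1r.
Qed.

Lemma rowexp_unit_mono i l : rowexp (unitv i) l = (mono i l)%:R.
Proof.
by rewrite (rowexp_unit S) monoE natrD natrM eq_sym.
Qed.

Lemma tau_shift m i j : p j = Some i ->
  tau_of (m + premono j) =
  (fun l => tau_of (m + U_(i) *+ a i) l - unitv i l + unitv j l).
Proof.
move=> pj; apply: (tau_ofE S) => l; rewrite rowexpD rowexpB (rowexp_tau_of S).
rewrite !rowexp_unit_mono (mono_premono j) [mono i l]monoE (pk pj) !mnmDE mulmnE.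
rewrite !mnm1E (inj_eq Some_inj) -!natr1 !natrD !natrM; ring.
Qed.

Lemma mono_le m i : (forall l, 1 <= rowexp (fun x => tau_of m x - unitv i x) l) ->
  cls m = 0.
Proof.
move=> H; rewrite -(@submK _ (mono i) m) ?cls_mono //; apply/mnm_lepP => l.
have := H l; rewrite rowexpB (rowexp_tau_of S) rowexp_unit_mono -(ler_nat rat) -natr1.
by lra.
Qed.

(** The measure that decreases in the proof of [red_nonneg]. *)
Definition neg_floor (x : rat) : nat := if x < 0 then `|Num.floor x|%N else 0%N.

Lemma neg_floor_ge0 x : 0 <= x -> neg_floor x = 0%N.
Proof. by rewrite /neg_floor; case: ltrP. Qed.

Lemma neg_floorS x : x < 0 -> (neg_floor (x + 1) < neg_floor x)%N.
Proof.
move=> x0; rewrite /neg_floor x0 (floorDrz x (rpred1 _)) floor1.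
have : Num.floor x < 0 by rewrite floor_lt0.
by case: ifP => _; case: (Num.floor x) => [z|z]; rewrite ?NegzE; lia.
Qed.

Lemma oapp_ge t c (o : option 'I_n) : c <= 0 -> (forall i, c <= t i) ->
  c <= oapp t 0 o.
Proof. by move=> c0 H; case: o => [i|] /=. Qed.

Lemma nat_ge1 (x : rat) : x \is a Num.int -> 0 < x -> 1 <= x.
Proof. by case/intrP=> z ->; rewrite (ltr_int _ 0) (ler_int _ 1). Qed.

Lemma rowexp_ge1 m l : 1 <= rowexp (tau_of m) l.
Proof. by rewrite (rowexp_tau_of S) (ler_nat _ 1). Qed.

Lemma mono_sub_int m i l :
  rowexp (fun x => tau_of m x - unitv i x) l \is a Num.int.
Proof.
by rewrite rowexpB (rowexp_tau_of S) rowexp_unit_mono rpredB // rpred_nat.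
Qed.

(** Shift a unit from [p j] to [j], where [t_j] is the most negative entry.  The
    exponent of [x_j] is positive, so [t_(p j)] is at least [1 + a_j |t_j|], and
    by the choice of [j] this makes [x_(p j)] occur with exponent at least
    [a_(p j)]: the shift is a relation of the ideal. *)
Lemma red_nonneg m : exists2 m', (forall i, 0 <= tau_of m' i) &
  exists c : F, cls m = c *: cls m'.
Proof.
have [N] := ubnP (\sum_i neg_floor (tau_of m i))%N; elim: N m => // N IH m leN.
have [/forallP t0|] := boolP [forall i, 0 <= tau_of m i].
  by exists m => //; exists 1; rewrite scale1r.
rewrite negb_forall => /existsP [j0]; rewrite -ltNge => tj0.
pose t := tau_of m; pose j := [arg min_(j < j0) t j]%O.
have minj i : t j <= t i by rewrite /j; case: arg_minP => // l _; apply.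
have tj : t j < 0 by apply: le_lt_trans tj0.
have aj := a2 j; have rj := rowexp_ge1 m j.
case pj : (p j) => [i|]; last by move: rj; rewrite /rowexp pj /= -/t; nra.
have {}rj : 1 <= (a j)%:R * t j + t i by move: rj; rewrite /rowexp pj.
have ij := pirr pj; have ai := a2 i.
have op : t j <= oapp t 0 (p i) by apply: oapp_ge => //; exact: ltW.
have mi : (U_(i) *+ a i <= m)%MM.
  apply/mnm_lepP => l; rewrite mulmnE mnm1E.
  have [<-|_] := eqVneq i l; last by [].
  rewrite mul1n -ltnS -(ltr_nat rat) -(rowexp_tau_of S) /rowexp -/t.
  have h : 0 <= ((a i)%:R - 2) * (t i - 1) by apply: mulr_ge0; nra.
  by nra.
have := cls_rel (m - U_(i) *+ a i) j; rewrite pj /= submK //.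
set m' := (_ + premono j)%MM => rel.
have tE : tau_of m' = fun l => t l - unitv i l + unitv j l.
  by rewrite /m' (tau_shift _ pj) submK.
have [|m'' m0 [c mc]] := IH m'.
  rewrite -ltnS (leq_trans _ leN) // ltnS tE.
  rewrite (bigD1 j) // [X in (_ < X)%N](bigD1 j) //= -addSn leq_add //.
    rewrite /unitv eqxx eq_sym (negPf ij) subr0; exact: neg_floorS.
  apply: leq_sum => l lj; rewrite /unitv (negPf lj) addr0.
  have [->|_] := eqVneq l i; last by rewrite subr0.
  by rewrite neg_floor_ge0 //= mulr1n; nra.
exists m'' => //; exists (- (a j)%:R * c).
rewrite -scalerA -mc scaleNr; apply/eqP; rewrite -addr_eq0 addrC; exact/eqP.
Qed.

(** The vectors of the unit cube that are not good: two consecutive ones, or a one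
    followed by an entry that is not integral, or at the end of a chain. *)
Definition bad m := (forall i, 0 <= tau_of m i <= 1) /\
  exists2 i, tau_of m i = 1 & forall j, k i = Some j -> tau_of m j <> 0.

(** A bad one at [i] can be moved back to [p i], where it meets the one that
    precedes the zero at [p i], so that the new vector is bad as well.  When [p i]
    is undefined or carries a nonzero entry the monomial lies in the ideal. *)
Lemma bad_step m : bad m -> cls m = 0 \/
  exists2 m', bad m' & exists2 c : F, `|c| < 1 & cls m = c *: cls m'.
Proof.
case=> t01 [i ti nk]; pose t := tau_of m.
have t0 l : 0 <= t l by have /andP [] := t01 l.
have aF : (a i)%:R != 0 :> F by rewrite pnatr_eq0; have := arrows_ge2 S i; lia.
have sub1 l : l != i -> 1 <= rowexp (fun x => t x - unitv i x) l.
  move=> li; apply: nat_ge1; first exact: mono_sub_int.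
  rewrite rowexpB rowexp_unit_mono monoE eq_sym (negPf li) muln0 add0n.
  case: eqP => [kl|_]; last by rewrite subr0 (lt_le_trans _ (rowexp_ge1 m l)).
  rewrite /rowexp (kp kl) /= [t i]ti mulr1n.
  have /eqP tl := nk _ kl; have tl0 : 0 < t l by rewrite lt_neqAle eq_sym tl t0.
  by have := a2 l; nra.
have mi : (premono i <= m)%MM.
  apply/mnm_lepP => l; have [->|li] := eqVneq l i.
    have : 0 <= rowexp (fun x => t x - unitv i x) i.
      rewrite /rowexp [t i]ti /unitv eqxx subrr mulr0 add0r.
      case pi : (p i) => [q|] //=; rewrite (negPf (pirr pi)) subr0; exact: t0.
    rewrite rowexpB (rowexp_tau_of S) rowexp_unit_mono mono_premono mnmDE mnm1E eqxx.
    by rewrite addn1 subr_ge0 ler_nat.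
  have := sub1 l li; rewrite rowexpB (rowexp_tau_of S) rowexp_unit_mono mono_premono.
  by rewrite mnmDE mnm1E eq_sym (negPf li) addn0 -(ler_nat rat) -natr1; lra.
have := cls_rel (m - premono i) i; rewrite submK //.
case pi : (p i) => [q|] /=; last first.
  by rewrite addr0 => /eqP; rewrite scaler_eq0 (negPf aF) => /eqP; left.
have qi := pirr pi; have kq := pk pi.
have [tq|tq] := eqVneq (t q) 0; last first.
  move=> _; left; apply: (mono_le (i := i)) => l.
  have [->|/sub1 //] := eqVneq l i.
  apply: nat_ge1; first exact: mono_sub_int.
  rewrite /rowexp pi /= /unitv (negPf qi) eqxx subr0 ti subrr mulr0 add0r.
  by rewrite lt_neqAle eq_sym tq t0.
set m' := (_ + U_(q) *+ a q)%MM => rel; right.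
have tE l : tau_of m' l = t l - unitv i l + unitv q l.
  have := tau_shift (m - premono i) pi; rewrite submK // -/t -/m' => ->.
  by rewrite /=; ring.
exists m'; last first.
  exists (- (a i)%:R^-1).
    rewrite normrN normfV ger0_norm // invf_lt1 ?ltr0n; last by have := arrows_ge2 S i; lia.
    by rewrite ltr1n; exact: (arrows_ge2 S).
  apply: (scalerI aF); rewrite scalerA mulrN divff // scaleN1r.
  by apply/eqP; rewrite -addr_eq0; exact/eqP.
split.
  move=> l; rewrite tE /unitv; have [->|li] := eqVneq l i.
    by rewrite [t i]ti [i == q]eq_sym (negPf qi).
  have [->|lq] := eqVneq l q; first by rewrite tq.
  by rewrite subr0 addr0.
have := rowexp_ge1 m q; rewrite /rowexp -/t tq mulr0 add0r.
case pq : (p q) => [r|] /=; last by rewrite lt_geF.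
have rq := pirr pq => tr.
have ri : r != i.
  by apply/eqP => e; rewrite e in pq; case: (nk _ (pk pq)).
have {}tr : t r = 1 by apply: le_anti; rewrite tr andbT; have /andP [] := t01 r.
exists r; first by rewrite tE /unitv (negPf ri) (negPf rq) tr.
move=> j; rewrite (pk pq) => -[<-]; rewrite tE tq /unitv (negPf qi) eqxx.
by rewrite subr0 add0r; apply/eqP; exact: oner_neq0.
Qed.

(** The factor [- 1 / a_i] of each step has absolute value less than one, and
    there are finitely many bad monomials. *)
Lemma bad_eq0 m : bad m -> cls m = 0.
Proof.
pose D := (\sum_i a i).+1; pose s := [seq bmnm x | x : 'X_{1..n < D}].
pose b x := `[< bad x >].
have bs x : bad x -> x \in filter b s.
  move=> bx; rewrite mem_filter; apply/andP; split; first exact/asboolP.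
  have dx : (mdeg x < D)%N.
    rewrite ltnS mdegE leq_sum // => i _; case: bx => t01 _.
    have := rowexp_tau_of S x i; rewrite /rowexp => e.
    have /andP [t0 t1] := t01 i; rewrite -(ler_nat rat).
    have : oapp (tau_of x) 0 (p i) <= 1.
      by case: (p i) => [j|] //=; have /andP [] := t01 j.
    by move: e; rewrite -natr1; have := a2 i; nra.
  by apply/mapP; exists (BMultinom dx); rewrite ?mem_enum.
move=> bm; apply: (contraction_eq0 (s := filter b s)); last exact: bs.
move=> x; rewrite mem_filter => /andP [/asboolP bx _].
have [x0|[y /bs ys yc]] := bad_step bx; last by exists y; [left|].
by exists x; [right|exists 0; rewrite ?normr0 ?ltr01 // x0 scaler0].
Qed.

Lemma red_good m : cls m = 0 \/ exists2 m', good a k p (tau_of m') &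
  exists c : F, cls m = c *: cls m'.
Proof.
have [m' t0 [c ->]] := red_nonneg m.
suff [->|g] : cls m' = 0 \/ good a k p (tau_of m').
- by left; rewrite scaler0.
- by right; exists m' => //; exists c.
pose t := tau_of m'; have rZ j : rowexp t j \is a Num.int.
  by rewrite (rowexp_tau_of S) rpred_nat.
have [/existsP [i ti]|] := boolP [exists i, 1 < t i].
  left; apply: (mono_le (i := i)) => l.
  apply: nat_ge1; first exact: mono_sub_int.
  rewrite rowexpB rowexp_unit_mono monoE.
  have op q : 0 <= oapp t 0 q by apply: oapp_ge.
  have [<-|il] := eqVneq i l.
    rewrite (negPf (arrows_irr S i)) addn0 muln1 /rowexp -/t.
    by have := op (p i); have := a2 i; nra.
  rewrite muln0 add0n; case: eqP => [kl|_].
    by rewrite /rowexp (kp kl) /= -/t; have := t0 l; have := a2 l; rewrite -/t; nra.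
  by rewrite subr0 (lt_le_trans _ (rowexp_ge1 m' l)).
rewrite negb_exists => /forallP t1.
have t01 i : 0 <= t i <= 1 by rewrite t0 leNgt t1.
have [bm|nb] := pselect (bad m'); first by left; exact: bad_eq0.
right; split=> //.
  move=> j tj; have := rowexp_ge1 m' j; rewrite /rowexp tj mulr0 add0r.
  case: (p j) => [i|] /=; last by rewrite lt_geF.
  move=> ti; exists i => //; apply: le_anti; rewrite ti andbT.
  by have /andP [] := t01 i.
move=> j tj; apply: contrapT => H; apply: nb; split=> //.
by exists j => // i ki ti; apply: H; exists i.
Qed.

End Spanning.

(** * Coordinates on the Milnor ring *)

Section Coef.
Variables (F : numFieldType) (n : nat).
Variables (a : 'I_n -> nat) (k p : 'I_n -> option 'I_n).
Hypothesis S : arrows a k p.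
Local Notation tau_of := (tau_of a k).
Implicit Types (t s : 'I_n -> rat) (m : 'X_{1..n}).

Definition poly_coef t (f : {mpoly F[n]}) : F :=
  \sum_(m <- msupp f) f@_m * ratr (good_coef t (tau_of m)).

Lemma poly_coefwE t b f : (msize f <= b)%N ->
  poly_coef t f = \sum_(m : 'X_{1..n < b}) f@_m * ratr (good_coef t (tau_of m)).
Proof.
move=> fb; rewrite /poly_coef; set I := 'X_{1..n < b}.
rewrite (big_mksub I) //=; first last.
- by move=> m /msize_mdeg_lt /leq_trans; apply.
- exact: msupp_uniq.
rewrite big_rmcond //= => i /memN_msupp_eq0 ->.
by rewrite mul0r.
Qed.

Lemma poly_coef_is_linear t : linear_for *%R (poly_coef t).
Proof.
move=> c f g; pose b := maxn (msize (c *: f + g)) (maxn (msize f) (msize g)).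
rewrite !(@poly_coefwE t b) ?leq_max ?leqnn ?orbT //.
rewrite mulr_sumr -big_split /=; apply: eq_bigr => m _.
by rewrite mcoeffD mcoeffZ mulrDl -mulrA.
Qed.

HB.instance Definition _ t :=
  GRing.isLinear.Build F {mpoly F[n]} F *%R (poly_coef t) (poly_coef_is_linear t).

Lemma poly_coef_monom t m : poly_coef t 'X_[m] = ratr (good_coef t (tau_of m)).
Proof. by rewrite /poly_coef msuppX big_seq1 mcoeffX eqxx mul1r. Qed.

Lemma poly_coef_neq0 t f : poly_coef t f != 0 -> exists2 m, m \in msupp f &
  good_coef t (tau_of m) != 0.
Proof.
apply: contraPP => H; rewrite /poly_coef big_seq big1 ?eqxx // => m mf.
have [->|nz] := eqVneq (good_coef t (tau_of m)) 0; first by rewrite rmorph0 mulr0.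
by case: H; exists m.
Qed.

Lemma poly_coef_jacobian t f : good a k p t ->
  f \in jacobian (arrow_pot F a k) -> poly_coef t f = 0.
Proof.
move=> gt /asboolP [c ->]; rewrite linear_sum big1 // => j _.
rewrite (mpolyE (c j)) mulr_suml linear_sum big1 // => m _.
rewrite -scalerAl linearZ /= (deriv_pot F S) mulrDr linearD /=.
rewrite -scalerAr linearZ /= -mpolyXD poly_coef_monom.
set t1 := tau_of _; pose s l := t1 l - unitv j l.
have t1E : t1 = fun l => s l + unitv j l by apply/funext => l; rewrite /s subrK.
have rs l : rowexp a p s l = (m l + (l != j))%:R.
  rewrite /s rowexpB /t1 (rowexp_tau_of S) (rowexp_unit_mono S) (mono_premono S) !mnmDE.
  rewrite mnm1E eq_sym -natr1 !natrD; case: eqVneq => _ /=; ring.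
have := good_coef_rel S gt (s := s) (j := j).
rewrite -t1E => rel.
suff <- : ratr ((a j)%:R * good_coef t t1 + oapp
    (fun l => good_coef t (fun i => s i + unitv l i)) 0 (p j)) =
   (a j)%:R * ratr (good_coef t t1) + poly_coef t ('X_[m] *
     oapp (fun i => 'X_[U_(i) *+ a i]) 0 (p j)) :> F.
  rewrite rel ?rmorph0 ?mulr0 // => [l lj||]; rewrite rs.
  - by rewrite lj addn1 (ler_nat _ 1).
  - exact: ler0n.
  - exact: rpred_nat.
rewrite rmorphD rmorphM /= ratr_nat; congr (_ + _).
case pj : (p j) => [i|] /=; last by rewrite mulr0 linear0 rmorph0.
rewrite -mpolyXD poly_coef_monom; congr (ratr (good_coef t _)).
by apply/funext => l; rewrite /s /t1 (tau_shift S _ pj); ring.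
Qed.

(** The potential [U] is only propositionally equal to the one of the arrows in
    the applications, hence the separate parameter. *)
Definition milnor_coef (U : {mpoly F[n]}) t (x : milnor U) : F :=
  poly_coef t (generic_quotient.repr (x : Quotient.quot (jacobian U))).

Section Potential.
Variable U : {mpoly F[n]}.
Hypothesis UE : U = arrow_pot F a k.

Lemma milnor_coef_class t f : good a k p t -> milnor_coef t (milnor_class U f) = poly_coef t f.
Proof.
move=> gt; apply/eqP; rewrite -subr_eq0 -linearB /=; apply/eqP.
apply: poly_coef_jacobian => //; rewrite -UE.
by apply/milnor_classP; rewrite milnor_classK.
Qed.

(** A class is determined by its good coefficients.  The good monomials are
    enumerated by [g], since they will be indexed by mirror pairs. *)
Lemma milnor_expand (D : finType) (P : pred D) (g : D -> 'X_{1..n}) f :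
  {in P &, injective g} -> (forall d, P d -> good a k p (tau_of (g d))) ->
  (forall m, good a k p (tau_of m) -> exists2 d, P d & g d = m) ->
  milnor_class U f =
    \sum_(d | P d) poly_coef (tau_of (g d)) f *: milnor_class U 'X_[g d].
Proof.
move=> ginj gg gs.
have monom m : milnor_class U 'X_[m] =
    \sum_(d | P d) poly_coef (tau_of (g d)) 'X_[m] *: milnor_class U 'X_[g d].
  have H : milnor_class U 'X_[m] = 0 \/
      exists2 m', good a k p (tau_of m') &
      exists c : F, milnor_class U 'X_[m] = c *: milnor_class U 'X_[m'].
    by rewrite UE; exact: red_good.
  have [m0|[m' gm [c mc]]] := H.
    have c0 : milnor_class U 0 = 0 by exact: raddf0.
    rewrite big1 // => d Pd; rewrite -(milnor_coef_class _ (gg d Pd)) m0 -[X in milnor_coef _ X]c0.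
    by rewrite (milnor_coef_class _ (gg d Pd)) linear0 scale0r.
  have [d0 Pd0 gd0] := gs _ gm.
  have cE d : P d -> poly_coef (tau_of (g d)) 'X_[m] = c * (d == d0)%:R.
    move=> Pd; rewrite -(milnor_coef_class _ (gg d Pd)) mc -milnor_classZ.
    rewrite (milnor_coef_class _ (gg d Pd)) linearZ /= poly_coef_monom; congr (_ * _).
    have [->|dd0] := eqVneq d d0; first by rewrite gd0 good_coef_id rmorph1.
    have [->|/(good_coef_good (gg _ Pd) gm) e] := eqVneq (good_coef (tau_of (g d)) (tau_of m')) 0.
      by rewrite rmorph0.
    suff gdm : g d = m' by rewrite (ginj d d0) ?gd0 ?eqxx // in dd0.
    apply/mnmP => l; apply: succn_inj; apply/eqP.
    by rewrite -(eqr_nat rat) -!(rowexp_tau_of S) e.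
  rewrite (bigD1 d0) //= cE // eqxx mulr1 gd0 -mc big1 ?addr0 // => d /andP [Pd dd0].
  by rewrite cE // (negPf dd0) mulr0 scale0r.
rewrite {1}(mpolyE f).
have -> : milnor_class U (\sum_(m <- msupp f) f@_m *: 'X_[m]) =
    \sum_(m <- msupp f) f@_m *: milnor_class U 'X_[m].
  elim: (msupp f) => [|m s IH]; first by rewrite !big_nil; exact: raddf0.
  by rewrite !big_cons milnor_classD milnor_classZ IH.
under eq_bigr => m _ do rewrite monom scaler_sumr.
rewrite exchange_big /=; apply: eq_bigr => d _.
have -> : poly_coef (tau_of (g d)) f =
    \sum_(m <- msupp f) f@_m * poly_coef (tau_of (g d)) 'X_[m].
  rewrite {1}(mpolyE f) linear_sum; apply: eq_bigr => m _.
  by rewrite linearZ.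
by rewrite scaler_suml; apply: eq_bigr => m _; rewrite scalerA.
Qed.
End Potential.
End Coef.

(** * The map exp (2 i pi t) *)

Section Exp.
Variable R : realType.
Local Notation C := R[i].
Local Notation e := (@expi2pi R).

Lemma expi2piD x y : e (x + y) = e x * e y.
Proof.
rewrite /expi2pi mulrDr cosD sinD.
by apply/eqP; rewrite eq_complex /=; apply/andP; split; apply/eqP; ring.
Qed.

Lemma expi2pi0 : e 0 = 1.
Proof. by rewrite /expi2pi mulr0 cos0 sin0. Qed.

Lemma expi2pi1 : e 1 = 1.
Proof.
by rewrite /expi2pi mulr1 mulr_natl -[pi *+ 2]add0r cosD2pi sinD2pi cos0 sin0.
Qed.

Lemma expi2pi_neq0 x : e x != 0.
Proof.
apply/eqP => ex; have : e (x - x) = 1 by rewrite subrr expi2pi0.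
by rewrite expi2piD ex mul0r => /eqP; rewrite eq_sym oner_eq0.
Qed.

Lemma expi2piN x : e (- x) = (e x)^-1.
Proof.
apply: (mulfI (expi2pi_neq0 x)); rewrite -expi2piD subrr expi2pi0.
by rewrite mulfV ?expi2pi_neq0.
Qed.

Lemma expi2piXn x n : e x ^+ n = e (n%:R * x).
Proof.
elim: n => [|n IH]; first by rewrite mul0r expi2pi0.
by rewrite exprS IH -expi2piD -natr1 mulrDl mul1r addrC.
Qed.

Lemma expi2piXz x (z : int) : e x ^ z = e (z%:~R * x).
Proof.
case: z => n; first exact: expi2piXn.
by rewrite NegzE -exprnN expi2piXn -expi2piN -mulNr mulrNz.
Qed.

Lemma expi2pi_sum (I : Type) (r : seq I) (P : pred I) (f : I -> R) :
  e (\sum_(i <- r | P i) f i) = \prod_(i <- r | P i) e (f i).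
Proof. exact: (big_morph e expi2piD expi2pi0). Qed.

Lemma expi2pi_eq1_itv x : 0 <= x < 1 -> e x = 1 -> x = 0.
Proof.
move=> /andP [x0 x1] /eqP; rewrite eq_complex /= => /andP [/eqP c1 /eqP s0].
have pi0 := pi_gt0 R; apply/eqP; apply: contraT => nx.
have {}x0 : 0 < x by rewrite lt_neqAle eq_sym nx.
have [xh|xh|xh] := ltgtP x 2^-1.
- have := sin_gt0_pi (x := 2 * pi * x); rewrite s0 ltxx => H.
  have : false by apply: H; apply/andP; split; nra.
  by [].
- have := sin_gt0_pi (x := 2 * pi * x - pi).
  have := sinDpi (2 * pi * x - pi); rewrite subrK s0 => /eqP.
  rewrite eq_sym oppr_eq0 => /eqP ->; rewrite ltxx => H.
  have : false by apply: H; apply/andP; split; nra.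
  by [].
- move: c1; rewrite xh (_ : 2 * pi * 2^-1 = pi); last by field.
  by rewrite cospi; lra.
Qed.

Lemma expi2pi_int x : x \is a Num.int -> e x = 1.
Proof.
by case/intrP => z ->; rewrite -[z%:~R]mulr1 -expi2piXz expi2pi1 exp1rz.
Qed.

Lemma expi2pi_eq1 x : (e x == 1) = (x \is a Num.int).
Proof.
apply/eqP/idP => [ex|]; last exact: expi2pi_int.
have : e (x - (Num.floor x)%:~R) = 1.
  by rewrite expi2piD ex mul1r expi2pi_int // rpredN intr_int.
move/expi2pi_eq1_itv => H; have := floor_itv x; rewrite intrD => /andP [f0 f1].
rewrite -(subrK (Num.floor x)%:~R x) H ?add0r ?intr_int //.
by apply/andP; split; lra.
Qed.

Lemma expi2pi_eq x y : (e x == e y) = (x - y \is a Num.int).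
Proof.
rewrite -expi2pi_eq1 expi2piD expi2piN.
by rewrite -[RHS](inj_eq (mulIf (expi2pi_neq0 y))) divfK ?expi2pi_neq0 // mul1r.
Qed.

Lemma phase_expi2pi x : 0 <= x < 1 -> phase (e x) = x.
Proof.
move=> x01; rewrite /phase; case: xgetP => [y _ [y01 exy]|]; last first.
  by move=> /(_ x) /=; case.
have : y - x \is a Num.int by rewrite -expi2pi_eq exy.
case/intrP => z yx; have zm1 : (-1 : R) < z%:~R by rewrite -yx; lra.
have z1 : z%:~R < (1 : R) by rewrite -yx; lra.
move: zm1 z1; rewrite (ltr_int _ (-1)) (ltr_int _ _ 1) => zm1 z1.
by move: yx; rewrite (_ : z = 0); [lra|lia].
Qed.

Lemma expi2pi_surj (z : C) : `|z| = 1 -> exists x, z = e x.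
Proof.
case: z => x y; rewrite normc_def /= => /eqP; rewrite eq_complex /= eqxx andbT.
move=> /eqP n1; have xy : x ^+ 2 + y ^+ 2 = 1.
  by rewrite -[LHS]sqr_sqrtr ?n1 ?expr1n // addr_ge0 ?sqr_ge0.
have x1 : -1 <= x <= 1.
  by rewrite -ler_norml -ler_sqr ?nnegrE // real_normK ?num_real // expr1n -xy;
     rewrite lerDl sqr_ge0.
have pi0 := pi_gt0 R.
have acx : cos (acos x) = x by apply: acosK; rewrite in_itv.
have sacx : sin (acos x) = `|y|.
  by rewrite sin_acos // (_ : 1 - x ^+ 2 = y ^+ 2) ?sqrtr_sqr // -xy; ring.
have aux (t : R) : 2 * pi * (t / (2 * pi)) = t.
  by rewrite mulrC divfK // mulf_neq0 ?pnatr_eq0 // lt0r_neq0.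
case: (lerP 0 y) => y0.
  exists (acos x / (2 * pi)); rewrite /expi2pi aux acx sacx.
  by rewrite ger0_norm.
exists (- acos x / (2 * pi)); rewrite /expi2pi aux cosN sinN acx sacx.
by rewrite ltr0_norm // opprK.
Qed.

Lemma expq_eq1 (x : rat) : (e (ratr x) == 1) = (x \is a Num.int).
Proof.
rewrite expi2pi_eq1; apply/idP/idP => [/intrP [z xz]|/intrP [z ->]]; last first.
  by rewrite ratr_int intr_int.
suff -> : x = z%:~R by rewrite intr_int.
by apply: (fmorph_inj (@ratr R)); rewrite /= ratr_int.
Qed.

End Exp.

(** * Arrow matrices and diagonal symmetries *)

(** Both sides are [t B x]. *)
Lemma sum_rowexp n a k p (x t : 'I_n -> rat) : arrows a k p ->
  \sum_j x j * rowexp a p t j = \sum_i t i * rowexp a k x i.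
Proof.
move=> S; under eq_bigr => j _ do rewrite mulrDr -sum_pre mulr_sumr.
rewrite big_split /= (exchange_big_dep predT) //= -big_split /=.
apply: eq_bigr => i _; rewrite mulrDr; congr (_ + _); first by ring.
rewrite -sum_pre mulr_sumr; apply: eq_big => [j|j _]; last by ring.
by rewrite (arrows_kp S).
Qed.

(** The rows of [A] are matched with the variables by [s].  The permutation is
    kept, because reordering the rows of [A] renames the variables of the
    transposed potential. *)
Record arrow_matrix N (A : 'M[nat]_N) (s : 'S_N) (a : 'I_N -> nat)
    (k p : 'I_N -> option 'I_N) : Prop := ArrowMatrix {
  am_arrows : arrows a k p;
  amE : forall i j, A (s i) j = (a i * (i == j) + (k i == Some j))%N }.

Lemma arrow_matrix_tr N (A : 'M[nat]_N) s a k p : arrow_matrix A s a k p ->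
  arrow_matrix A^T s^-1%g (fun v => a (s^-1%g v))
    (fun v => omap s (p (s^-1%g v))) (fun v => omap s (k (s^-1%g v))).
Proof.
case=> S AE.
have omapE (o : option 'I_N) v : (omap s o == Some v) = (o == Some (s^-1%g v)).
  case: o => [i|] //=; rewrite !(inj_eq Some_inj).
  by apply/eqP/eqP => [<-|->]; rewrite ?permK ?permKV.
split; first split.
- by move=> i; exact: arrows_ge2 S _.
- by move=> i j; rewrite !omapE (arrows_kp S).
- by move=> i; rewrite omapE -(arrows_kp S) (arrows_irr S).
move=> i j; rewrite mxE -{1}(permKV s j) AE omapE (arrows_kp S).
rewrite (inj_eq perm_inj) eq_sym; congr (_ + _)%N.
by case: eqVneq => [->|]; rewrite ?muln0.
Qed.

Section Sector.
Variables (R : realType) (N : nat) (A : 'M[nat]_N) (s : 'S_N).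
Variables (a : 'I_N -> nat) (k p : 'I_N -> option 'I_N).
Hypothesis AM : arrow_matrix A s a k p.
Local Notation C := R[i].
Let S := am_arrows AM.
Implicit Types (h : 'I_N -> C).

Lemma exponent_mx_row (x : 'cV[rat]_N) i :
  (exponent_mx A *m x) (s i) 0 = rowexp a k (x^~ 0) i.
Proof.
rewrite mxE /rowexp -sum_pre [X in _ = _ + X]big_mkcond /=.
rewrite (bigD1 i) //= !mxE (amE AM) eqxx (negPf (arrows_irr S i)).
rewrite addn0 muln1; congr (_ + _).
rewrite big_mkcond; apply: eq_bigr => j _; rewrite !mxE (amE AM).
have [->|ij] := eqVneq j i; first by rewrite (negPf (arrows_irr S i)).
by rewrite muln0 add0n; case: eqP => _; rewrite ?mul1r ?mul0r.
Qed.

Lemma exponent_mx_col (t : 'rV[rat]_N) j :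
  (t *m exponent_mx A) 0 j = rowexp a p (fun i => t 0 (s i)) j.
Proof.
have := congr1 (fun v : 'rV[rat]_N => v 0 j) (mulmx_arrow S (fun i => t 0 (s i))).
rewrite !mxE => <-; rewrite (reindex_inj (@perm_inj _ s)) /=.
apply: eq_bigr => i _; rewrite !mxE (amE AM) natrD natrM.
by rewrite mulr_natr.
Qed.

Lemma exponent_mx_unit : exponent_mx A \in unitmx.
Proof.
have := arrow_mx_unit S; have -> : arrow_mx a k = row_perm s (exponent_mx A).
  by apply/matrixP => i j; rewrite !mxE (amE AM) natrD natrM mulr_natr.
by rewrite row_permE unitmx_mul unitmx_perm.
Qed.

Lemma charge_rowexp i : rowexp a k (fun j => charge A j 0) i = 1.
Proof.
rewrite -(exponent_mx_row (charge A)) /charge mulmxA mulmxV ?exponent_mx_unit //.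
by rewrite mul1mx mxE.
Qed.

Lemma potential_arrow : potential R A = arrow_pot C a k.
Proof.
rewrite /potential /arrow_pot (reindex_inj (@perm_inj _ s)) /=.
apply: eq_bigr => i _; rewrite [RHS]mpolyXE_id; apply: eq_bigr => j _.
by rewrite (amE AM) monoE.
Qed.

(** The diagonal symmetries, in terms of the monomials of the potential. *)
Definition diag_sym h := forall i, \prod_j h j ^+ A i j = 1.

Lemma diag_symE h : diag_sym h <-> forall i, h i ^+ a i * oapp h 1 (k i) = 1.
Proof.
have E i : \prod_j h j ^+ A (s i) j = h i ^+ a i * oapp h 1 (k i).
  rewrite (bigD1 i) //= (amE AM) eqxx muln1 (negPf (arrows_irr S i)) addn0.
  congr (_ * _); transitivity (\prod_(j | k i == Some j) h j).
    rewrite big_mkcond [RHS]big_mkcond; apply: eq_bigr => j _.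
    rewrite (amE AM) [i == j]eq_sym; have [->|_] := eqVneq j i.
      by rewrite (negPf (arrows_irr S i)).
    by rewrite muln0 add0n; case: (k i == _).
  case: (k i) => [l|] /=; last by rewrite big_pred0.
  by rewrite (big_pred1 l) // => j /=; rewrite eq_sym.
split=> H i; first by rewrite -E.
by rewrite -(permKV s i) E.
Qed.

Lemma diag_sym_neq0 h : diag_sym h -> forall i, h i != 0.
Proof.
move=> /diag_symE H i; apply/eqP => h0; have := H i; rewrite h0 expr0n.
have := arrows_ge2 S i; case: (a i) => // q _ /=; rewrite mul0r => /eqP.
by rewrite eq_sym oner_eq0.
Qed.

(** The monomial of [i] takes the value [h_(k i)] at [h] when [h_i = 1]. *)
Lemma fix_closed h i j : diag_sym h -> i \in fix_set h -> k i = Some j ->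
  j \in fix_set h.
Proof.
move=> /diag_symE H; rewrite !inE => /eqP hi ki; have := H i.
by rewrite ki hi expr1n mul1r /= => ->.
Qed.

(** * The local system on the fixed coordinates *)

(** Fixed coordinates are renumbered by their rank in [I]. *)
Definition loc (I : {set 'I_N}) (o : option 'I_N) : option 'I_#|I| :=
  obind (fun i => [pick j : 'I_#|I| | enum_val j == i]) o.

Lemma locE I o j : (loc I o == Some j) = (o == Some (enum_val j)).
Proof.
case: o => [i|] //=; case: pickP => [l /eqP <-|none].
  by rewrite !(inj_eq Some_inj) (inj_eq enum_val_inj).
by apply/esym/negP => /eqP [e]; have := none j; rewrite e eqxx.
Qed.

Definition loc_a (I : {set 'I_N}) (j : 'I_#|I|) := a (enum_val j).
Definition loc_k (I : {set 'I_N}) (j : 'I_#|I|) := loc I (k (enum_val j)).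
Definition loc_p (I : {set 'I_N}) (j : 'I_#|I|) := loc I (p (enum_val j)).

Lemma loc_arrows I : arrows (@loc_a I) (@loc_k I) (@loc_p I).
Proof.
split=> [i|i j|i]; first exact: arrows_ge2 S _.
  by rewrite !locE (arrows_kp S).
by rewrite locE (arrows_irr S).
Qed.

(** The monomial of a variable outside the fixed locus contains that variable, and
    the monomial of a fixed variable only involves fixed variables. *)
Lemma restrict_potential h : diag_sym h ->
  restrict_to (fix_set h) (potential R A) =
  arrow_pot C (@loc_a (fix_set h)) (@loc_k (fix_set h)).
Proof.
move=> hA; rewrite potential_arrow /restrict_to; set I := fix_set h.
set z := mktuple _.
have monoX n' (a' : 'I_n' -> nat) k' i : 'X_[mono a' k' i] =
    'X_i ^+ a' i * oapp (fun j => 'X_j) 1 (k' i) :> {mpoly C[n']}.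
  rewrite /mono mpolyXD mpolyXn; congr (_ * _).
  by case: (k' i) => //=; rewrite mpolyX0.
rewrite /arrow_pot linear_sum (bigID (mem I)) /= [X in _ + X]big1 ?addr0.
  rewrite big_enum_val /=; apply: eq_bigr => j _; rewrite !monoX rmorphM rmorphXn /=.
  rewrite comp_mpolyXU -tnth_nth tnth_mktuple.
  have zE l : (if [pick j | enum_val j == enum_val l] is Some j then 'X_j else 0)
      = 'X_l :> {mpoly C[#|I|]}.
    case: pickP => [j' /eqP /enum_val_inj -> //|/(_ l)].
    by rewrite eqxx.
  rewrite zE; congr (_ * _).
  have kjI i : k (enum_val j) = Some i -> i \in I.
    by apply: fix_closed => //; exact: enum_valP.
  rewrite /loc_k; case: (k (enum_val j)) kjI => [i|] kjI /=; last by rewrite rmorph1.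
  rewrite comp_mpolyXU -tnth_nth tnth_mktuple.
  rewrite -(enum_rankK_in (kjI i erefl) (kjI i erefl)) zE.
  case: pickP => [j' /eqP /enum_val_inj -> //|].
  by move=> /(_ (enum_rank_in (kjI i erefl) i)); rewrite eqxx.
move=> i iI; rewrite monoX rmorphM rmorphXn /= comp_mpolyXU -tnth_nth.
rewrite tnth_mktuple; case: pickP => [j /eqP ji|_].
  by rewrite -ji enum_valP in iI.
by rewrite expr0n; have := arrows_ge2 S i; case: (a i) => // q _; rewrite mul0r.
Qed.

(** * Phases of diagonal symmetries *)

Lemma diag_sym_expq (x : 'I_N -> rat) :
  diag_sym (fun j => expi2pi (ratr (x j))) <-> forall i, rowexp a k x i \is a Num.int.
Proof.
have E i : expi2pi (ratr (x i)) ^+ a i * oapp (fun j => expi2pi (ratr (x j))) 1 (k i)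
    = expi2pi (ratr (rowexp a k x i)) :> C.
  rewrite expi2piXn /rowexp rmorphD rmorphM /= ratr_nat expi2piD; congr (_ * _).
  by case: (k i) => [l|] //=; rewrite rmorph0 expi2pi0.
split=> [/diag_symE H i|H]; first by rewrite -(expq_eq1 R) -E H.
by apply/diag_symE => i; apply/eqP; rewrite E expq_eq1.
Qed.

(** The logarithms of the absolute values of the [h_j] and the phases of [h]
    modulo integers both solve linear systems with matrix [A]: the first are
    zero, the second rational. *)
Lemma diag_sym_expi h : diag_sym h -> exists2 x : 'I_N -> rat,
  (forall j, 0 <= x j < 1) & forall j, h j = expi2pi (ratr (x j)).
Proof.
move=> hA; have h0 := diag_sym_neq0 hA.
pose n j : R := complex.Re `|h j|.
have nE j : `|h j| = (n j)%:C%C by rewrite /n RRe_real // normr_real.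
have n0 j : 0 < n j by have := normr_gt0 (h j); rewrite h0 nE ltcR.
have n1 j : n j = 1.
  pose y j := ln (n j).
  have Ey i : (a i)%:R * y i + oapp y 0 (k i) = 0.
    have /diag_symE /(_ i) := hA; move/(congr1 Num.norm).
    rewrite normrM normrX normr1 nE -rmorphXn /=.
    have -> : `|oapp h 1 (k i)| = (oapp n 1 (k i))%:C%C.
      by case: (k i) => [l|] //=; rewrite normr1.
    rewrite -rmorphM /= => /complexI /(congr1 (@ln R)).
    rewrite ln1 lnM ?posrE ?exprn_gt0 // ?lnXn // -/(y i); last first.
      by case: (k i) => [l|] //=; rewrite ltr01.
    rewrite mulr_natl => e; rewrite -[RHS]e; congr (_ + _).
    by case: (k i) => [l|] //=; rewrite ln1.
  have /(_ j) y0 := diag_dominant (arrows_ge2 S) Ey.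
  by apply: ln_inj; rewrite ?posrE ?ltr01 // -/(y j) y0 ln1.
have /choice [x hx] : forall j, exists x : R, h j = expi2pi x.
  by move=> j; apply: expi2pi_surj; rewrite nE n1.
have bZ i : (a i)%:R * x i + oapp x 0 (k i) \is a Num.int.
  rewrite -expi2pi_eq1 expi2piD -expi2piXn -hx.
  have /diag_symE /(_ i) <- := hA; apply/eqP; congr (_ * _).
  by case: (k i) => [l|] /=; rewrite ?hx ?expi2pi0.
have /choice [b hb] : forall i, exists b : int,
    (a i)%:R * x i + oapp x 0 (k i) = b%:~R.
  by move=> i; have /intrP := bZ i.
pose q : 'cV[rat]_N := invmx (exponent_mx A) *m \col_i (b (s^-1%g i))%:~R.
have qE i : rowexp a k (q^~ 0) i = (b i)%:~R.
  rewrite -exponent_mx_row /q mulmxA mulmxV ?exponent_mx_unit // mul1mx mxE.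
  by rewrite permK.
have xq j : x j = ratr (q j 0).
  pose y j := x j - ratr (q j 0).
  have Ey i : (a i)%:R * y i + oapp y 0 (k i) = 0.
    have := hb i; rewrite -(ratr_int R) -qE /rowexp rmorphD rmorphM /= ratr_nat.
    by rewrite /y; case: (k i) => [l|] /=; rewrite ?rmorph0; lra.
  apply/eqP; rewrite -subr_eq0; apply/eqP.
  exact: (diag_dominant (arrows_ge2 S) Ey).
exists (fun j => q j 0 - (Num.floor (q j 0))%:~R) => j.
  have := floor_itv (q j 0); rewrite intrD => /andP [f0 f1].
  by apply/andP; split; lra.
rewrite hx xq; apply/eqP; rewrite expi2pi_eq rmorphB /= ratr_int opprB addrC.
by rewrite subrK intr_int.
Qed.
End Sector.

(** * Mirror pairs *)

(** The index of a basis vector of the sum of all the sectors: [u] is a vector of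
    phases of the sector, [w] the exponent vector of the form.  A coordinate with
    [u_j = 0] or [u_j = 1] is fixed by the sector; it is the ones of [u] that
    record the zeros of a good [w]. *)
Record mirror_pair n (k p : 'I_n -> option 'I_n) (u w : 'I_n -> rat) : Prop := MirrorPair {
  mp_u01 : forall j, 0 <= u j <= 1;
  mp_w01 : forall j, 0 <= w j <= 1;
  mp_uw : forall j, (u j == 0) = (w j != 0);
  mp_w1 : forall j, w j = 1 -> exists2 l, k j = Some l & u l = 1;
  mp_u1 : forall j, u j = 1 -> exists2 l, p j = Some l & w l = 1 }.

Lemma is01P (x : rat) : 0 <= x <= 1 -> is01 x = (x \is a Num.int).
Proof.
move=> x01; apply/idP/idP => [/orP [] /eqP -> //|/intrP [z ez]].
move: x01; rewrite ez (ler_int _ 0) (ler_int _ _ 1) => z01.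
by have : (z == 0) || (z == 1) by [lia]; rewrite /is01; case/orP => /eqP ->.
Qed.

Section Data.
Variables (R : realType) (N : nat) (A : 'M[nat]_N) (s : 'S_N).
Variables (a : 'I_N -> nat) (k p : 'I_N -> option 'I_N).
Hypothesis AM : arrow_matrix A s a k p.
Variable M : nat.
Hypothesis aM : forall j, (a j < M)%N.
Local Notation C := R[i].
Local Notation E := (exponent_mx A).
Local Notation lA I := (@loc_a N a I).
Local Notation lK I := (@loc_k N k I).
Local Notation lP I := (@loc_p N p I).
Let S := am_arrows AM.
Implicit Types (h : 'I_N -> C) (I : {set 'I_N}).

(** Mirror pairs are encoded by the integral vectors [A u] and [w A], whose
    entries are bounded, so as to sum over a finite type; exchanging the two
    components then serves both [A] and its transpose. *)
Definition code : finType :=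
  ({ffun 'I_N -> 'I_M.+1} * {ffun 'I_N -> 'I_M.+1})%type.
Implicit Types (d : code).

Definition ucol d j : rat := (invmx E *m \col_i (d.1 i)%:R) j 0.
Definition trow d i : rat := ((\row_j (d.2 j)%:R) *m invmx E) 0 i.
(** The rows of [A] are renumbered by the variables they are matched with. *)
Definition wrow d j : rat := trow d (s j).

Lemma rowexp_u d i : rowexp a k (ucol d) i = (d.1 (s i))%:R.
Proof.
rewrite -(exponent_mx_row AM) mulmxA mulmxV ?(exponent_mx_unit AM) //.
by rewrite mul1mx mxE.
Qed.

Lemma rowexp_w d j : rowexp a p (wrow d) j = (d.2 j)%:R.
Proof.
have := exponent_mx_col AM (\row_j (d.2 j)%:R *m invmx E) j.
by rewrite mulmxKV ?(exponent_mx_unit AM) // mxE => ->.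
Qed.

Definition is_mirror d : bool := `[< mirror_pair k p (ucol d) (wrow d) >].

Definition sector_of d : 'I_N -> C := fun j => expi2pi (ratr (ucol d j)).

(** It is given for every [I], not only for the fixed locus of the sector of [d],
    to avoid transporting monomials along equalities of sectors. *)
Definition local_monomial I d : 'X_{1..#|I|} :=
  [multinom (d.2 (enum_val j)).-1 | j < #|I|].

Lemma diag_sym_sector d : diag_sym A (sector_of d).
Proof. by apply/(diag_sym_expq R AM) => i; rewrite rowexp_u rpred_nat. Qed.

Lemma fix_sec d j : is_mirror d -> (j \in fix_set (sector_of d)) = is01 (ucol d j).
Proof.
by move/asboolP => D; rewrite inE expq_eq1 is01P ?(mp_u01 D).
Qed.

Lemma enum_valI I j : j \in I -> exists i : 'I_#|I|, enum_val i = j.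
Proof. by move=> jI; exists (enum_rank_in jI j); rewrite enum_rankK_in. Qed.

Lemma loc_oapp I (f : 'I_N -> rat) o : (forall i, i \notin I -> f i = 0) ->
  oapp (fun j => f (enum_val j)) 0 (loc I o) = oapp f 0 o.
Proof.
move=> f0; case: o => [i|] //=; case: pickP => [j /eqP <- //|none] /=.
have [iI|/f0 //] := boolP (i \in I).
by have [j ji] := enum_valI iI; have := none j; rewrite ji eqxx.
Qed.

(** Exactly one of [u_j] and [w_j] vanishes. *)
Lemma wrow_off d j : is_mirror d -> j \notin fix_set (sector_of d) -> wrow d j = 0.
Proof.
move=> Dd; rewrite (fix_sec _ Dd) negb_or => /andP [u0 _].
by move/asboolP: Dd => D; apply/eqP; move: u0; rewrite (mp_uw D) negbK.
Qed.

Lemma d2_off d j : is_mirror d -> j \notin fix_set (sector_of d) -> d.2 j = 0%N :> nat.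
Proof.
move=> Dd jI; apply/eqP; rewrite -(eqr_nat rat) -rowexp_w /rowexp wrow_off // mulr0 add0r.
case pj : (p j) => [i|] //=; rewrite wrow_off //; apply: contra jI => iI.
by apply: (fix_closed AM (diag_sym_sector d) iI); apply/eqP; rewrite (arrows_kp S) pj.
Qed.

Definition local_w h d (j : 'I_#|fix_set h|) : rat := wrow d (enum_val j).

Lemma rowexp_local_w h d j : is_mirror d -> sector_of d = h ->
  rowexp (lA _) (lP _) (@local_w h d) j = (d.2 (enum_val j))%:R.
Proof.
move=> Dd hd; rewrite -rowexp_w /rowexp /loc_p /local_w; congr (_ + _).
by apply: loc_oapp => i; rewrite -hd; exact: wrow_off.
Qed.

Lemma local_w_good h d : is_mirror d -> sector_of d = h ->
  good (lA _) (lK _) (lP _) (@local_w h d).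
Proof.
move=> Dd hd; move/asboolP: (Dd) => D.
have fixE j : (j \in fix_set h) = is01 (ucol d j) by rewrite -hd fix_sec.
split=> [i|j wj|j wj|j].
- exact: mp_w01 D _.
- have uj : ucol d (enum_val j) = 1.
    have := enum_valP j; rewrite fixE => /orP [] /eqP //.
    by move/eqP; rewrite (mp_uw D) [wrow _ _]wj eqxx.
  have [l pl wl] := mp_u1 D uj.
  have lI : l \in fix_set h.
    by rewrite fixE /is01 (mp_uw D) wl oner_eq0.
  have [i il] := enum_valI lI; exists i; last by rewrite /local_w il.
  by apply/eqP; rewrite locE pl il.
- have [l kl ul] := mp_w1 D wj.
  have lI : l \in fix_set h by rewrite fixE /is01 ul eqxx orbT.
  have [i il] := enum_valI lI; exists i; first by apply/eqP; rewrite locE kl il.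
  have := mp_uw D l; rewrite ul oner_eq0 /local_w il => /esym/negbFE/eqP.
  by [].
- by rewrite rowexp_local_w // rpred_nat.
Qed.

Lemma d2_gt0 h d j : is_mirror d -> sector_of d = h -> j \in fix_set h -> (0 < d.2 j)%N.
Proof.
move=> Dd hd jI; have [i ij] := enum_valI jI.
have := good_rowexp_ge1 (loc_arrows AM _) i (local_w_good Dd hd).
by rewrite rowexp_local_w // (ler_nat _ 1) ij.
Qed.

Lemma local_monomial_succ h d j : is_mirror d -> sector_of d = h ->
  (local_monomial (fix_set h) d j).+1 = d.2 (enum_val j).
Proof.
by move=> Dd hd; rewrite mnmE prednK // (d2_gt0 Dd hd) // enum_valP.
Qed.

Lemma tau_local_monomial h d : is_mirror d -> sector_of d = h ->
  tau_of (lA _) (lK _) (local_monomial (fix_set h) d) = @local_w h d.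
Proof.
move=> Dd hd; apply: (tau_ofE (loc_arrows AM _)) => j.
by rewrite rowexp_local_w // local_monomial_succ.
Qed.

Lemma phase_sec d j : is_mirror d ->
  phase (sector_of d j) = if ucol d j == 1 then 0 else ratr (ucol d j).
Proof.
move/asboolP => D; case: eqP => [u1|/eqP u1].
  by rewrite /sector_of u1 rmorph1 expi2pi1 -expi2pi0 phase_expi2pi // lexx ltr01.
have /andP [u0 ule] := mp_u01 D j.
by apply: phase_expi2pi; rewrite ler0q -(rmorph1 (@ratr R)) ltr_rat u0 lt_neqAle u1.
Qed.

Lemma code_inj d1 d2 : (forall j, wrow d1 j = wrow d2 j) ->
  (forall j, ucol d1 j = ucol d2 j) -> d1 = d2.
Proof.
move=> w12 u12; have {}w12 : wrow d1 = wrow d2 by apply/funext.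
have {}u12 : ucol d1 = ucol d2 by apply/funext.
case: d1 d2 w12 u12 => [x1 y1] [x2 y2] w12 u12; congr pair; apply/ffunP => i.
  apply/val_inj/eqP; rewrite /= -(eqr_nat rat) -(permKV s i).
  by rewrite -(rowexp_u (x1, y1)) -(rowexp_u (x2, y2)) u12.
apply/val_inj/eqP; rewrite /= -(eqr_nat rat).
by rewrite -(rowexp_w (x1, y1)) -(rowexp_w (x2, y2)) w12.
Qed.

Lemma local_monomial_inj h d1 d2 : is_mirror d1 -> is_mirror d2 ->
  sector_of d1 = h -> sector_of d2 = h ->
  local_monomial (fix_set h) d1 = local_monomial (fix_set h) d2 -> d1 = d2.
Proof.
move=> D1 D2 h1 h2 /mnmP e.
have w12 j : wrow d1 j = wrow d2 j.
  have [jI|jI] := boolP (j \in fix_set h); last by rewrite !wrow_off ?h1 ?h2.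
  have [i <-] := enum_valI jI.
  have /(congr1 (@^~ i)) := tau_local_monomial D1 h1; rewrite -[RHS]/(wrow _ _) => <-.
  have /(congr1 (@^~ i)) := tau_local_monomial D2 h2; rewrite -[RHS]/(wrow _ _) => <-.
  by congr (tau_of _ _ _ i); apply/mnmP.
apply: code_inj => // j.
move: (D1) (D2) => /asboolP P1 /asboolP P2.
have e0 : (ucol d1 j == 0) = (ucol d2 j == 0) by rewrite (mp_uw P1) (mp_uw P2) w12.
have := phase_sec j D1; have := phase_sec j D2; rewrite h1 h2 => ->.
case: eqP => u2; case: eqP => u1; first by rewrite u1 u2.
- by move=> /esym/eqP; rewrite fmorph_eq0 e0 u2 oner_eq0.
- by move=> /eqP; rewrite fmorph_eq0 -e0 u1 oner_eq0.
- by move=> /fmorph_inj.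
Qed.

Lemma rowexp_bound q (f : 'I_N -> rat) j : (forall i, 0 <= f i <= 1) ->
  rowexp a q f j \is a Num.int -> exists v : 'I_M.+1, rowexp a q f j = v%:R.
Proof.
move=> f01 fZ; have /andP [fj0 fj1] := f01 j.
have : 0 <= oapp f 0 (q j) <= 1.
  by case: (q j) => [i|] //=; rewrite lexx ler01.
case/andP=> q0 q1.
have r0 : 0 <= rowexp a q f j by rewrite /rowexp; apply: addr_ge0 => //; apply: mulr_ge0.
have rM : rowexp a q f j <= (a j).+1%:R.
  rewrite /rowexp -natr1; apply: lerD => //; rewrite -[leRHS]mulr1.
  by apply: ler_wpM2l.
have /natrP [v ev] : rowexp a q f j \is a Num.nat by rewrite natrEint fZ r0.
have vM : (v < M.+1)%N.
  by rewrite ltnS; move: rM; rewrite ev ler_nat => /leq_trans; apply; exact: aM.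
by exists (Ordinal vM).
Qed.

(** Given the sector and a good vector on its fixed locus, [w] is the extension of
    that vector by zero, and [u] is the vector of phases corrected to be [1] where
    [w] vanishes on the fixed locus. *)
Lemma local_monomial_surj h m : diag_sym A h ->
  good (lA _) (lK _) (lP _) (tau_of (lA (fix_set h)) (lK (fix_set h)) m) ->
  exists2 d, is_mirror d & sector_of d = h /\ local_monomial (fix_set h) d = m.
Proof.
move=> hA; set I := fix_set h; set t := tau_of _ _ m => gt.
have SI := loc_arrows AM I.
have [x x01 hx] := diag_sym_expi AM hA.
pose w j := oapp t 0 (loc I (Some j)).
have wE i : w (enum_val i) = t i.
  rewrite /w; have /eqP -> // : loc I (Some (enum_val i)) == Some i.
  by rewrite locE.
have w0 j : j \notin I -> w j = 0.
  move=> jI; rewrite /w /=; case: pickP => [i /eqP ij|] //=.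
  by rewrite -ij enum_valP in jI.
pose u j := if j \in I then (w j == 0)%:R else x j.
have u01 j : 0 <= u j <= 1.
  rewrite /u; case: ifP => _; last by have /andP [-> /ltW ->] := x01 j.
  by case: (_ == _); rewrite ?lexx ?ler01.
have w01 j : 0 <= w j <= 1.
  have [jI|/w0 ->] := boolP (j \in I); last by rewrite lexx ler01.
  by have [i <-] := enum_valI jI; rewrite wE (good01 gt).
have x_int j : j \in I -> x j = 0.
  rewrite inE hx expq_eq1 -is01P => [/orP [] /eqP // x1|].
    by have := x01 j; rewrite x1 ltxx andbF.
  by have /andP [-> /ltW ->] := x01 j.
have ux j : u j - x j \is a Num.int.
  rewrite /u; case: ifP => [/x_int ->|_]; last by rewrite subrr.
  by rewrite subr0 rpred_nat.
have rw i : rowexp (lA I) (lP I) t i = rowexp a p w (enum_val i).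
  rewrite /rowexp wE; congr (_ + _); rewrite -(loc_oapp _ w0) /loc_p.
  by case: (loc _ _) => //= l; rewrite wE.
have closed i j : i \in I -> k i = Some j -> j \in I := fix_closed AM hA.
have wZ j : rowexp a p w j \is a Num.int.
  have [jI|jI] := boolP (j \in I).
    by have [i <-] := enum_valI jI; rewrite -rw (goodZ gt).
  rewrite /rowexp w0 // mulr0 add0r; case pj : (p j) => [i|] //=.
  rewrite w0 ?rpred0 //; apply: contra jI => iI.
  by apply: (closed _ _ iI); apply/eqP; rewrite (arrows_kp S) pj.
have uZ j : rowexp a k u j \is a Num.int.
  have xZ : rowexp a k x j \is a Num.int.
    move: j; apply/(diag_sym_expq R AM).
    by rewrite (_ : (fun j => _) = h) //; apply/funext => j; rewrite hx.
  have -> : rowexp a k u j = rowexp a k x j + rowexp a k (fun i => u i - x i) j.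
    by rewrite rowexpB; ring.
  rewrite rpredD // /rowexp rpredD ?rpredM ?rpred_nat //.
  by case: (k j).
have /choice [v2 hv2] j := rowexp_bound w01 (wZ j).
have /choice [v1 hv1] j := rowexp_bound u01 (uZ j).
pose d : code := ([ffun i => v1 (s^-1%g i)], [ffun j => v2 j]).
have du : ucol d = u.
  apply: (rowexp_inj (arrows_rev S)) => j; rewrite rowexp_u hv1 /=.
  by rewrite ffunE permK.
have dw : wrow d = w.
  by apply: (rowexp_inj S) => j; rewrite rowexp_w hv2 /= ffunE.
exists d; first (apply/asboolP; rewrite du dw; split=> //).
- move=> j; rewrite /u; case: ifP => [jI|/negbT jI].
    by case: (w j == 0); rewrite ?eqxx ?oner_eq0.
  rewrite w0 // eqxx; apply/negbTE; apply: contra jI => /eqP xj.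
  by rewrite inE hx xj rmorph0 expi2pi0.
- move=> j wj; have jI : j \in I.
    by apply: contraT => /w0 e; rewrite e in wj.
  have [i ij] := enum_valI jI; move: wj; rewrite -ij wE => /(good1 gt) [l ki tl].
  exists (enum_val l); first by apply/eqP; rewrite -locE; apply/eqP.
  by rewrite /u enum_valP wE tl eqxx.
- move=> j; rewrite /u; case: ifP => [jI|_ xj]; last first.
    by have := x01 j; rewrite xj ltxx andbF.
  have [i ij] := enum_valI jI; rewrite -ij wE; case: eqP => // /(good0 gt) [l pi tl] _.
  exists (enum_val l); first by apply/eqP; rewrite -locE; apply/eqP.
  by rewrite wE.
split.
  apply/funext => j; rewrite /sector_of du /u; case: ifP => [|_]; last by rewrite hx.
  by rewrite inE => /eqP ->; case: (_ == _); rewrite /= ?rmorph1 ?rmorph0 ?expi2pi1 ?expi2pi0.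
apply/mnmP => i; rewrite mnmE /= ffunE; apply: succn_inj.
have e : (v2 (enum_val i) : nat) = (m i).+1.
  by apply/eqP; rewrite -(eqr_nat rat) -hv2 -rw (rowexp_tau_of SI).
by rewrite e.
Qed.
End Data.

(** * Coordinates on the sum of the sectors *)

Section Coordinates.
Variables (R : realType) (N : nat) (A : 'M[nat]_N) (s : 'S_N).
Variables (a : 'I_N -> nat) (k p : 'I_N -> option 'I_N).
Hypothesis AM : arrow_matrix A s a k p.
Variable M : nat.
Hypothesis aM : forall j, (a j < M)%N.
Local Notation C := R[i].
Local Notation V := (potential R A).
Local Notation lA I := (@loc_a N a I).
Local Notation lK I := (@loc_k N k I).
Local Notation lP I := (@loc_p N p I).
Local Notation code := (code N M).
Local Notation is_mirror := (is_mirror A s k p).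
Local Notation sector_of := (sector_of R A).
Local Notation ucol := (ucol A).
Local Notation wrow := (wrow A s).
Implicit Types (h : 'I_N -> C) (I : {set 'I_N}) (d : code).
Local Notation cls h f := (milnor_class (restrict_to (fix_set h) V) f).

Definition sector_coord h d (x : sector V h) : C :=
  milnor_coef (lA (fix_set h)) (lK (fix_set h)) (local_w A s (h := h) d) x.

Definition scoord d (x : sectors V) : C := sector_coord d (x (sector_of d)).

Definition assemble (y : code -> C) : sectors V := fun h =>
  \sum_(d | is_mirror d && `[< sector_of d = h >]) y d *: cls h 'X_[local_monomial (fix_set h) d].

Lemma scoordE h d x : sector_of d = h -> scoord d x = sector_coord d (x h).
Proof. by move=> <-. Qed.

Lemma diag_sym_of h d : sector_of d = h -> diag_sym A h.
Proof. by move=> <-; exact (diag_sym_sector R AM d). Qed.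

Lemma sector_coord_class h d f : is_mirror d -> sector_of d = h ->
  sector_coord d (cls h f) = poly_coef (lA (fix_set h)) (lK (fix_set h)) (local_w A s (h := h) d) f.
Proof.
move=> Dd hd; have hA := diag_sym_of hd.
apply: (milnor_coef_class (loc_arrows AM _) (restrict_potential AM hA)).
exact: (local_w_good AM Dd hd).
Qed.

Lemma sector_coord_linear h d c (x y : sector V h) : is_mirror d -> sector_of d = h ->
  sector_coord d (c *: x + y) = c * sector_coord d x + sector_coord d y.
Proof.
move=> Dd hd; rewrite -[x]milnor_classK -[y]milnor_classK -milnor_classZ.
by rewrite -milnor_classD !sector_coord_class // linearD linearZ.
Qed.

Lemma sector_coord0 h d : is_mirror d -> sector_of d = h -> sector_coord d (0 : sector V h) = 0.
Proof.
move=> Dd hd; have c0 : cls h 0 = 0 by exact: raddf0.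
by rewrite -[X in sector_coord _ X]c0 sector_coord_class // linear0.
Qed.

Lemma class_sum h (P : pred code) (y : code -> C) (g : code -> {mpoly C[_]}) :
  \sum_(d | P d) y d *: cls h (g d) = cls h (\sum_(d | P d) y d *: g d).
Proof.
elim: (index_enum _) => [|d l IH].
  by rewrite !big_nil; apply/esym; exact: raddf0.
rewrite !big_cons; case: ifP => // _.
by rewrite IH milnor_classD milnor_classZ.
Qed.

Lemma scoord_assemble y d : is_mirror d -> scoord d (assemble y) = y d.
Proof.
move=> Dd; set h := sector_of d; rewrite (scoordE (h := h)) // /assemble.
rewrite class_sum sector_coord_class //.
rewrite linear_sum (bigD1 d) /= ?Dd ?asboolT // big1 ?addr0 => [|d'].
  rewrite linearZ /= poly_coef_monom (tau_local_monomial AM Dd) // good_coef_id rmorph1 mulr1 //.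
case/andP=> /andP [Dd' /asboolP hd'] dd'; rewrite linearZ /= poly_coef_monom.
rewrite (tau_local_monomial AM Dd') //; set t := local_w _ _ _; set t' := local_w _ _ _.
have [->|nz] := eqVneq (good_coef t t') 0; first by rewrite rmorph0 mulr0.
have tt : t' = t.
  apply: good_coef_good nz; [exact: (local_w_good AM Dd _)|exact: (local_w_good AM Dd' hd')].
case/eqP: dd'; apply: (local_monomial_inj AM Dd' Dd hd' (erefl h)).
apply/mnmP => i; apply: succn_inj; apply/eqP.
rewrite (local_monomial_succ AM _ Dd' hd') (local_monomial_succ AM _ Dd (erefl h)).
rewrite -(eqr_nat rat) -(rowexp_local_w AM _ Dd' hd') -(rowexp_local_w AM _ Dd (erefl h)).
by rewrite -/t -/t' tt.
Qed.

Lemma assemble_scoord x : (forall h, x h <> 0 -> diag_sym A h) -> assemble (scoord^~ x) = x.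
Proof.
move=> xA; apply: functional_extensionality_dep => h.
have [x0|/eqP x0] := eqVneq (x h) 0.
  rewrite x0 /assemble big1 // => d /andP [Dd /asboolP hd].
  by rewrite (scoordE _ hd) x0 sector_coord0 // scale0r.
have hA := xA _ x0.
have [f xf] : exists f, x h = cls h f by eexists; apply/esym/milnor_classK.
rewrite /assemble [RHS]xf (milnor_expand (loc_arrows AM _)
  (restrict_potential AM hA) (P := fun d : code => is_mirror d && `[< sector_of d = h >])
  (g := fun d => local_monomial (fix_set h) d)).
- apply: eq_bigr => d /andP [Dd /asboolP hd].
  by rewrite (tau_local_monomial AM Dd hd) (scoordE _ hd) xf sector_coord_class.
- move=> d1 d2 /andP [D1 /asboolP h1] /andP [D2 /asboolP h2].
  exact: (local_monomial_inj AM D1 D2 h1 h2).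
- move=> d /andP [Dd /asboolP hd]; rewrite (tau_local_monomial AM Dd hd).
  exact: (local_w_good AM Dd hd).
move=> m /(local_monomial_surj AM aM hA) [d Dd [hd dm]].
by exists d => //; rewrite Dd asboolT.
Qed.

(** * Invariant vectors in coordinates *)

(** The basis vector of [d] lies in a sector of [K] and is invariant; the exponents
    [d.2] include the contribution of the volume form. *)
Definition admissible (K : set ('I_N -> C)) d : Prop :=
  K (sector_of d) /\ forall g, K g -> \prod_j g j ^+ d.2 j = 1.

Lemma prod_off h d (g : 'I_N -> C) : is_mirror d -> sector_of d = h ->
  \prod_j g j ^+ d.2 j = \prod_(j < #|fix_set h|) g (enum_val j) ^+ d.2 (enum_val j).
Proof.
move=> Dd hd; rewrite (bigID (mem (fix_set h))) /= [X in _ * X]big1 ?mulr1.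
  by rewrite big_enum_val.
by move=> j jI; rewrite (d2_off (R := R) AM Dd) ?hd // expr0.
Qed.

Lemma form_actionX I (g : 'I_N -> C) (m : 'X_{1..#|I|}) :
  form_action g ('X_[m] : {mpoly C[#|I|]}) =
  (\prod_j g (enum_val j) ^+ (m j).+1) *: 'X_[m].
Proof.
rewrite /form_action comp_mpolyX.
rewrite (eq_bigr (fun i => g (enum_val i) ^+ m i *: 'X_i ^+ m i)); last first.
  by move=> i _; rewrite tnth_mktuple exprZn.
rewrite scaler_prod -mpolyXE_id scalerA big_enum_val; congr (_ *: _).
by rewrite -big_split /=; apply: eq_bigr => i _; rewrite exprS.
Qed.

Lemma form_action_sum (I : {set 'I_N}) (g : 'I_N -> C) (T : Type) (r : seq T)
    (P : pred T) (c : T -> C) (f : T -> {mpoly C[#|I|]}) :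
  form_action g (\sum_(i <- r | P i) c i *: f i) =
  \sum_(i <- r | P i) c i *: form_action g (f i).
Proof.
elim: r => [|i r IH]; first by rewrite !big_nil /form_action linear0 scaler0.
by rewrite !big_cons; case: ifP => // _; rewrite form_actionD IH.
Qed.

(** Monomials with a nonzero coefficient on the same good monomial have exponent
    vectors that differ by integral combinations of the rows of [A], hence the
    same character. *)
Lemma poly_coef_action h d (g : 'I_N -> C) (f : {mpoly C[#|fix_set h|]}) :
  is_mirror d -> sector_of d = h -> diag_sym A g ->
  poly_coef (lA (fix_set h)) (lK (fix_set h)) (local_w A s (h := h) d) (form_action g f) =
  (\prod_j g j ^+ d.2 j) *
  poly_coef (lA (fix_set h)) (lK (fix_set h)) (local_w A s (h := h) d) f.
Proof.
move=> Dd hd gA; rewrite {1 2}(mpolyE f) form_action_sum !linear_sum mulr_sumr.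
apply: eq_bigr => m _; rewrite form_actionX !linearZ /= poly_coef_monom.
rewrite mulrCA; set t := local_w _ _ _; set tm := tau_of _ _ _.
have [->|nz] := eqVneq (good_coef t tm) 0; first by rewrite rmorph0 !mulr0.
congr (_ * _); rewrite (prod_off _ Dd hd).
have [x _ gx] := diag_sym_expi AM gA; have SI := loc_arrows AM (fix_set h).
pose xI (j : 'I_#|fix_set h|) := x (enum_val j).
have E (e : 'I_#|fix_set h| -> nat) : \prod_j g (enum_val j) ^+ e j =
    expi2pi (ratr (\sum_j xI j * (e j)%:R)).
  rewrite rmorph_sum expi2pi_sum; apply: eq_bigr => j _.
  by rewrite gx expi2piXn rmorphM /= ratr_nat mulrC.
rewrite !E; apply/eqP; rewrite expi2pi_eq -rmorphB /=.
suff : \sum_j xI j * (m j).+1%:R - \sum_j xI j * (d.2 (enum_val j))%:R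
    \is a Num.int by case/intrP => z ->; rewrite ratr_int intr_int.
under eq_bigr => j _ do rewrite -(rowexp_tau_of SI).
under [X in _ - X]eq_bigr => j _ do rewrite -(rowexp_local_w AM _ Dd hd).
rewrite !(sum_rowexp _ _ SI) -sumrB rpred_sum // => i _; rewrite -mulrBl rpredM //.
  move: nz; rewrite /good_coef; case: ifP => [/andP [/forallP /(_ i)] //|_].
  by rewrite eqxx.
rewrite -(expq_eq1 R) /rowexp rmorphD rmorphM /= ratr_nat expi2piD -expi2piXn -gx.
have <- : oapp g 1 (k (enum_val i)) = expi2pi (ratr (oapp xI 0 (loc_k k i))).
  rewrite /loc_k; case ki : (k (enum_val i)) => [l|] /=; last by rewrite rmorph0 expi2pi0.
  have lI : l \in fix_set h.
    have hA := diag_sym_of hd.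
    by apply: (fix_closed AM hA _ ki); exact: enum_valP.
  case: pickP => [j /eqP <-|none] /=; first by rewrite gx.
  by have [j ji] := enum_valI lI; have := none j; rewrite ji eqxx.
by move/(diag_symE AM): gA => ->.
Qed.

Lemma state_admissible (K : set ('I_N -> C)) x d :
  (forall g, K g -> diag_sym A g) -> x \in @state_pred C N V K ->
  is_mirror d -> scoord d x <> 0 -> admissible K d.
Proof.
move=> KA /asboolP [_ xK xinv] Dd c0.
have x0 : x (sector_of d) <> 0.
  by move=> x0; apply: c0; rewrite /scoord x0 sector_coord0.
split=> [|g Kg]; first exact: xK.
have [f fx gx] := xinv (sector_of d) g Kg; move: c0.
have e : sector_coord d (x (sector_of d)) =
    (\prod_j g j ^+ d.2 j) * sector_coord d (x (sector_of d)).
  rewrite -{1}gx -fx !sector_coord_class //; exact: (poly_coef_action _ Dd erefl (KA _ Kg)).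
rewrite /scoord => /eqP nz; apply: (mulIf nz); rewrite mul1r -e //.
Qed.

Lemma assemble_state (K : set ('I_N -> C)) y :
  (forall d, is_mirror d -> y d <> 0 -> admissible K d) -> assemble y \in @state_pred C N V K.
Proof.
move=> yK; have rec0 h : assemble y h <> 0 -> exists2 d, is_mirror d & sector_of d = h /\ y d <> 0.
  move=> r0; apply: contrapT => H; apply: r0; rewrite /assemble big1 // => d.
  case/andP => Dd /asboolP hd; have [->|/eqP yd] := eqVneq (y d) 0.
    by rewrite scale0r.
  by case: H; exists d.
apply/asboolP; split.
- apply: (sub_finite_set (B := [set sector_of d | d in [set: code]]%classic)).
    by move=> h /rec0 [d _ [hd _]]; exists d.
  by apply: finite_image; exact: finite_finset.
- by move=> h /rec0 [d Dd [<- yd]]; have [] := yK d Dd yd.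
move=> h g Kg; exists (\sum_(d | is_mirror d && `[< sector_of d = h >])
  y d *: 'X_[local_monomial (fix_set h) d]).
  by rewrite -class_sum.
rewrite form_action_sum /assemble class_sum; congr (cls h _).
apply: eq_bigr => d /andP [Dd /asboolP hd].
have [->|/eqP yd] := eqVneq (y d) 0; first by rewrite !scale0r.
congr (_ *: _); rewrite form_actionX.
under eq_bigr => j _ do rewrite (local_monomial_succ AM _ Dd hd).
have [_ /(_ g Kg)] := yK d Dd yd.
by rewrite (prod_off _ Dd hd) => ->; rewrite scale1r.
Qed.

(** * Homogeneous vectors in coordinates *)

Lemma charge_loc h i : diag_sym A h ->
  rowexp (lA _) (lK _) (fun j : 'I_#|fix_set h| => charge A (enum_val j) 0) i = 1.
Proof.
move=> hA; rewrite -(charge_rowexp AM (enum_val i)) /rowexp; congr (_ + _).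
rewrite /loc_k; case ki : (k (enum_val i)) => [l|] //=.
have lI : l \in fix_set h.
  by apply: (fix_closed AM hA _ ki); exact: enum_valP.
case: pickP => [j /eqP <-|none] //=.
by have [j ji] := enum_valI lI; have := none j; rewrite ji eqxx.
Qed.

(** The charges solve [B q = 1], so the exponents [m + 1 = t B] have total charge
    [\sum_i t_i]. *)
Lemma weightE h (e : 'X_{1..#|fix_set h|}) t : diag_sym A h ->
  (forall j, rowexp (lA _) (lP _) t j = (e j).+1%:R) ->
  weight A e = ratr (\sum_i t i - \sum_(j in fix_set h) charge A j 0) :> R.
Proof.
move=> hA et; pose Q (j : 'I_#|fix_set h|) : rat := charge A (enum_val j) 0.
have -> : \sum_i t i = \sum_j Q j * (e j).+1%:R.
  under [RHS]eq_bigr => j _ do rewrite -et.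
  rewrite (sum_rowexp _ _ (loc_arrows AM _)); apply: eq_bigr => i _.
  by rewrite charge_loc // mulr1.
rewrite [X in _ - X]big_enum_val -sumrB rmorph_sum; apply: eq_bigr => j _.
by rewrite -natr1 mulrDr mulr1 addrK rmorphM /= ratr_nat mulrC.
Qed.

Lemma weight_good_coef h d (m : 'X_{1..#|fix_set h|}) : is_mirror d -> sector_of d = h ->
  good_coef (local_w A s (h := h) d) (tau_of (lA (fix_set h)) (lK (fix_set h)) m) != 0 ->
  weight (R := R) A m = weight A (local_monomial (fix_set h) d).
Proof.
move=> Dd hd; set t := local_w _ _ _; set tm := tau_of _ _ _ => nz.
have SI := loc_arrows AM (fix_set h).
have : \sum_i (tm i - t i) = 0.
  by move: nz; rewrite /good_coef; case: ifP => [/andP [_ /eqP] //|]; rewrite eqxx.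
rewrite sumrB => /eqP; rewrite subr_eq0 => /eqP tt.
have w1 := weightE (diag_sym_of hd) (fun j => rowexp_tau_of SI m j).
have tl j : rowexp (lA _) (lP _) t j = (local_monomial (fix_set h) d j).+1%:R.
  by rewrite (rowexp_local_w AM _ Dd hd) (local_monomial_succ AM _ Dd hd).
have w2 := weightE (diag_sym_of hd) tl.
by apply: etrans w1 _; rewrite -/tm tt; exact: esym w2.
Qed.

Lemma weight_local_monomial h d : is_mirror d -> sector_of d = h ->
  weight A (local_monomial (fix_set h) d) =
  ratr (\sum_i wrow d i - \sum_(j in fix_set h) charge A j 0) :> R.
Proof.
move=> Dd hd; set t := local_w A s (h := h) d.
have tl j : rowexp (lA _) (lP _) t j = (local_monomial (fix_set h) d j).+1%:R.
  by rewrite (rowexp_local_w AM _ Dd hd) (local_monomial_succ AM _ Dd hd).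
have <- : \sum_i t i = \sum_i wrow d i.
  rewrite [RHS](bigID (mem (fix_set h))) /= [X in _ = _ + X]big1; last first.
    by move=> j jI; apply: (wrow_off (R := R) Dd); rewrite hd.
  by rewrite addr0 [RHS]big_enum_val.
exact: (weightE (diag_sym_of hd) tl).
Qed.

(** A vector is homogeneous exactly when the basis vectors that occur in it have
    the right bidegree: reducing a monomial to good ones preserves the weight. *)
Lemma has_bidegreeE (bideg : forall h, 'X_{1..#|fix_set h|} -> R * R) K
    (x : state_space V K) (b : R * R) :
  (forall h m m', weight (R := R) A m = weight A m' -> bideg h m = bideg h m') ->
  (forall g, K g -> diag_sym A g) ->
  has_bidegree bideg b x <->
  forall d, is_mirror d -> scoord d (val x) <> 0 -> bideg (sector_of d) (local_monomial _ d) = b.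
Proof.
move=> bw KA; have /asboolP [_ xK _] := valP x; split=> [xb d Dd c0|H h].
  have [f fx fb] := xb (sector_of d); move: c0; rewrite /scoord -fx sector_coord_class //.
  move/eqP/poly_coef_neq0 => [m mf nz]; rewrite -(fb m mf).
  by apply: bw; apply/esym; exact: (weight_good_coef Dd erefl nz).
exists (\sum_(d | is_mirror d && `[< sector_of d = h >])
  scoord d (val x) *: 'X_[local_monomial (fix_set h) d]).
  rewrite -class_sum -[RHS](_ : assemble (scoord^~ (val x)) h = _) //.
  by rewrite assemble_scoord // => h' /xK /KA.
move=> m; rewrite mcoeff_msupp linear_sum /=.
have [/existsP [d]|] := boolP [exists d : code, [&& is_mirror d, `[< sector_of d = h >],
    scoord d (val x) != 0 & local_monomial (fix_set h) d == m]].
  case/and4P => Dd /asboolP hd /eqP c0 /eqP <- _; rewrite -(H d Dd c0).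
  by case: _ / hd.
rewrite negb_exists => /forallP H0; rewrite big1 ?eqxx // => d /andP [Dd hd].
rewrite mcoeffZ mcoeffX; have := H0 d; rewrite Dd hd /=.
by case: eqP => [->|_]; rewrite ?mul0r //=; case: eqP; rewrite ?mulr0.
Qed.
End Coordinates.

(** * Separation of a vector from a lattice *)

(** Biduality for finite abelian groups, in coordinates: a lattice [L] containing
    the image of [Z] is cut out by functionals that are integral on it.  In the
    Smith normal form of a generating matrix [L] is given by divisibility
    conditions on the coordinates, each of which is such a functional. *)
Lemma lattice_separation N (Z : 'M[int]_N) (L : 'cV[int]_N -> Prop) b :
  \det Z != 0 -> L 0 -> (forall x y, L x -> L y -> L (x + y)) ->
  (forall x, L x -> L (- x)) -> (forall e, L (Z *m e)) -> ~ L b ->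
  exists2 psi : 'rV[rat]_N,
    exists r : 'rV[int]_N, map_mx intr r = psi *m map_mx intr Z &
    (forall x, L x -> (psi *m map_mx intr x) 0 0 \is a Num.int) /\
    (psi *m map_mx intr b) 0 0 \isn't a Num.int.
Proof.
move=> detZ L0 LD LN LZ nLb.
have Ln x (n : nat) : L x -> L (x *+ n).
  by move=> Lx; elim: n => [|n IH]; rewrite ?mulr0n // mulrS; exact: LD.
have Lz x (n : int) : L x -> L (n *: x).
  move=> Lx; case: n => n; first by rewrite -natz scaler_nat; exact: Ln.
  by rewrite NegzE scaleNr -natz scaler_nat; exact/LN/Ln.
pose dd := `|\det Z|%N; have dd0 : (0 < dd)%N by rewrite absz_gt0.
have Ldd x : L (dd%:Z *: x).
  have Ldet : L (\det Z *: x).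
    by rewrite -mul_scalar_mx -mul_mx_adj -mulmxA.
  rewrite /dd abszE; have [Z0|Z0] := leP 0 (\det Z).
    by rewrite ger0_norm.
  by rewrite ltr0_norm // scaleNr; exact: LN.
(* [L] contains all multiples of [dd], so it is generated by those and by its
   elements with entries between 0 and [dd - 1]. *)
pose T := {ffun 'I_N -> 'I_dd}.
pose vec (t : T) : 'cV[int]_N := \col_i (t i : nat)%:Z.
pose M0 : 'M[int]_(N, #|T|) :=
  \matrix_(i, j) if `[< L (vec (enum_val j)) >] then vec (enum_val j) i 0 else 0.
pose M := row_mx M0 (dd%:Z)%:M.
have LM z : L (M *m z).
  have -> : M *m z = \sum_j z j 0 *: col j M.
    apply/colP => i; rewrite mxE summxE; apply: eq_bigr => j _.
    by rewrite !mxE mulrC.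
  apply: big_ind => // j _; apply: Lz; rewrite /M.
  case: (split_ordP j) => j' ->.
    rewrite colKl; have [Lj|nLj] := pselect (L (vec (enum_val j'))).
      suff -> : col j' M0 = vec (enum_val j') by [].
      by apply/colP => i; rewrite mxE [in LHS]mxE asboolT.
    suff -> : col j' M0 = 0 by [].
    by apply/colP => i; rewrite mxE [in LHS]mxE asboolF // mxE.
  rewrite colKr; have -> : col j' (dd%:Z)%:M = dd%:Z *: delta_mx j' 0 :> 'cV_N.
    by apply/colP => i; rewrite !mxE andbT mulr_natr.
  exact: Ldd.
have ML x : L x -> exists z, x = M *m z.
  move=> Lx.
  pose xi i := x i 0.
  have lt i : (`|modz (xi i) dd| < dd)%N.
    rewrite -ltz_nat gez0_abs ?modz_ge0 ?ltz_pmod // ?ltz_nat //.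
    by rewrite eqz_nat -lt0n.
  pose t : T := [ffun i => Ordinal (lt i)].
  pose y : 'cV[int]_N := \col_i divz (xi i) dd.
  have xE : x = vec t + dd%:Z *: y.
    apply/colP => i; rewrite !mxE ffunE /= gez0_abs ?modz_ge0 ?eqz_nat -?lt0n //.
    by rewrite addrC mulrC -divz_eq.
  have Lt : L (vec t).
    by rewrite -[vec t](addrK (dd%:Z *: y)) -xE; apply: LD => //; exact/LN/Ldd.
  exists (col_mx (delta_mx (enum_rank t) 0) y).
  rewrite mul_row_col mul_scalar_mx {1}xE; congr (_ + _).
  rewrite -colE; apply/colP => i.
  by rewrite [RHS]mxE [RHS]mxE enum_rankK asboolT.
have [U uU [W uW [dl _ ME]]] := int_Smith_normal_form M.
set D := \matrix_(i, j) _ in ME.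
have DE z i : (D *m z) i 0 = dl`_i * z (widen_ord (leq_addl _ _) i) 0.
  rewrite mxE (bigD1 (widen_ord (leq_addl _ _) i)) //= mxE eqxx mulr1n.
  rewrite big1 ?addr0 // => j ji; rewrite mxE.
  case: eqP => [e|_]; last by rewrite mulr0n mul0r.
  by case/eqP: ji; apply: val_inj; rewrite /= e.
have Ldvd x i : L x -> (invmx U *m x) i 0 \in dvdz dl`_i.
  case/ML => z ->; rewrite ME -!mulmxA mulKmx // DE.
  exact: dvdz_mulr.
have dvdL x : (forall i, (invmx U *m x) i 0 \in dvdz dl`_i) -> L x.
  move=> H; pose z : 'cV[int]_(#|T| + N) :=
    \col_j oapp (fun i : 'I_N => divz ((invmx U *m x) i 0) dl`_i) 0 (insub (j : nat)).
  have -> : x = M *m (invmx W *m z); last exact: LM.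
  rewrite ME !mulmxA mulmxK // -[LHS](mulKVmx uU) -mulmxA; congr (_ *m _).
  apply/colP => i; rewrite DE.
  have -> : z (widen_ord (leq_addl _ _) i) 0 = divz ((invmx U *m x) i 0) dl`_i.
    rewrite [LHS]mxE; case: insubP => [i' _ unitv|] /=; last by rewrite ltn_ord.
    by rewrite (val_inj unitv : i' = i).
  by rewrite mulrC divzK.
have /existsP [i ndvd] : [exists i : 'I_N, (invmx U *m b) i 0 \notin dvdz dl`_i].
  rewrite -negb_forall; apply/negP => /forallP H; apply: nLb.
  by apply: dvdL.
have dli : dl`_i != 0.
  apply/eqP => d0; have := Ldvd _ i (Ldd (U *m delta_mx i 0)).
  rewrite -scalemxAr mulKmx // d0 dvd0z !mxE !eqxx mulr1.
  by rewrite eqz_nat => /eqP e; rewrite e in dd0.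
have dq : (dl`_i)%:~R != 0 :> rat by rewrite intr_eq0.
have E q (X : 'M[int]_(N, q)) j :
    (((dl`_i)%:~R^-1 *: map_mx intr (row i (invmx U))) *m map_mx intr X) 0 j
    = (dl`_i)%:~R^-1 * ((invmx U *m X) i j)%:~R :> rat.
  rewrite -scalemxAl -map_mxM -row_mul [LHS]mxE; congr (_ * _).
  by rewrite [LHS]mxE; congr (_%:~R); rewrite [LHS]mxE.
exists ((dl`_i)%:~R^-1 *: map_mx intr (row i (invmx U))).
  exists (\row_j divz ((invmx U *m Z) i j) dl`_i).
  apply/rowP => j; rewrite E [LHS]mxE [X in X%:~R = _]mxE.
  have dv : (invmx U *m Z) i j \in dvdz dl`_i.
    have := Ldvd _ i (LZ (delta_mx j 0)); rewrite mulmxA -colE mxE.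
    by [].
  by apply: (mulfI dq); rewrite mulrA mulfV // mul1r -intrM mulrC divzK.
split=> [x Lx|].
  by rewrite E -(divzK (Ldvd x i Lx)) intrM mulrCA mulVf // mulr1 intr_int.
rewrite E; apply: contra ndvd => /intrP [z ez]; apply/dvdzP; exists z.
apply: (@intr_inj rat); rewrite intrM -ez mulrAC mulVf ?mul1r //.
Qed.

(** * The Kreuzer-Skarke normal form *)

Section KreuzerSkarke.
Variables (R : realType) (N : nat) (A : 'M[nat]_N).
Hypothesis A_ge2 : exponents_ge2 A.
Hypothesis W_isol : isolated_critical_point_at_origin (potential R A).
Local Notation C := R[i].

Lemma potential_row : potential R A = \sum_i 'X_[[multinom A i j | j < N]].
Proof.
apply: eq_bigr => i _; rewrite [RHS]mpolyXE_id; apply: eq_bigr => j _.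
by rewrite mnmE.
Qed.

Lemma meval_deriv (b : 'I_N) (x : 'I_N -> C) : (potential R A)^`M(b).@[x] =
  \sum_l (A l b)%:R * \prod_c x c ^+ (A l c - (b == c)).
Proof.
rewrite potential_row (raddf_sum (mderiv b)) (raddf_sum (meval x)); apply: eq_bigr => l _ /=.
rewrite mderivX mevalZ mevalX mnmE; congr (_ * _); apply: eq_bigr => c _.
by rewrite mnmBE mnmE mnm1E.
Qed.

Lemma prod_eq0 (x : 'I_N -> C) (e : 'I_N -> nat) c :
  x c = 0 -> (0 < e c)%N -> \prod_c x c ^+ e c = 0.
Proof.
move=> xc ec; rewrite (bigD1 c) //= xc expr0n.
by case: (e c) ec => // q _; rewrite mul0r.
Qed.

(** If no partial derivative contained a power of [x_i] alone, all of them would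
    vanish on the whole axis of [x_i]. *)
Lemma row_form i : exists l (m : nat) (o : option 'I_N),
  [/\ (2 <= m)%N, o != Some i & forall c, A l c = (m * (i == c) + (o == Some c))%N].
Proof.
have [l [j [Aj Al]]] : exists l j, (0 < A l j)%N /\
    forall c, c != i -> (A l c - (j == c) = 0)%N.
  apply: contrapT => H; have [_ [e e0 Hx]] := W_isol.
  pose x c : C := if c == i then (e / 2)%:C%C else 0.
  suff /(_ i) : forall c, x c = 0 by rewrite /x eqxx => /complexI; lra.
  apply: Hx => [c|b]; rewrite ?/x.
  - case: ifP => _; last by rewrite normr0 ltcR.
    by rewrite normc_def /= expr0n addr0 sqrtr_sqr ltcR gtr0_norm; lra.
  - rewrite meval_deriv big1 // => l _.
    have [->|Ab] := posnP (A l b); first by rewrite mul0r.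
    suff [c ci cb] : exists2 c, c != i & (0 < A l c - (b == c))%N.
      by rewrite (prod_eq0 (c := c)) ?mulr0 // (negPf ci).
    apply: contrapT => nc; apply: H; exists l, b; split=> // c ci.
    by apply/eqP; rewrite -leqn0 leqNgt; apply/negP => ?; apply: nc; exists c.
have Al' c : c != i -> (A l c <= (j == c))%N by move/Al; lia.
have Ai : (2 <= A l i)%N.
  have [c c2] := A_ge2 l; have [<- //|/Al'] := eqVneq c i.
  by case: (j == c) => /= h; lia.
exists l; have [ji|ji] := eqVneq j i.
  exists (A l i), None; split=> // c; rewrite addn0.
  have [<-|ic] := eqVneq i c; first by rewrite muln1.
  by have := Al' c; rewrite eq_sym ic ji (negPf ic) muln0 leqn0 => /(_ isT)/eqP.
exists (A l i), (Some j); split=> // c.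
rewrite (inj_eq Some_inj); have [<-|ic] := eqVneq i c.
  by rewrite (negPf ji) muln1 addn0.
rewrite muln0 add0n; have := Al' c; rewrite eq_sym ic => /(_ isT).
by have [<-|_] := eqVneq j c => /=; lia.
Qed.

Lemma norm_expi2pi (x : R) : `|expi2pi x| = 1.
Proof. by rewrite normc_def /= cos2Dsin2 sqrtr1. Qed.

(** Two monomials [x_i ^ a_i * x_j] and [x_i' ^ a_i' * x_j] with the same [j] would
    leave [x_i ^ a_i + x_i' ^ a_i'] as the only derivative that does not vanish on
    the plane of [x_i] and [x_i'], so that the critical points would contain a
    curve through the origin. *)
Lemma kreuzer_skarke : exists s a k p, @arrow_matrix N A s a k p.
Proof.
have /choice [l /choice [a /choice [k H]]] := row_form.
have a2 i : (2 <= a i)%N by have [] := H i.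
have kirr i : k i != Some i by have [] := H i.
have AE i c : A (l i) c = (a i * (i == c) + (k i == Some c))%N by have [_ _ ->] := H i.
have linj : injective l.
  move=> i i' e; apply/eqP; apply: contraT => ii'.
  have := AE i i; have := AE i' i; rewrite -e eqxx eq_sym (negPf ii') => -> .
  by have := a2 i; case: (_ == _); case: (_ == _); lia.
have kinj i i' j : k i = Some j -> k i' = Some j -> i = i'.
  move=> ki ki'; apply/eqP; apply: contraT => ii'; exfalso.
  have ji : j != i by have := kirr i; rewrite ki (inj_eq Some_inj).
  have ji' : j != i' by have := kirr i'; rewrite ki' (inj_eq Some_inj).
  have [_ [e e0 Hx]] := W_isol.
  pose t : R := Num.min 1 e / 2.
  have t0 : 0 < t by rewrite /t divr_gt0 // lt_min ltr01 e0.
  have t1 : t <= 1 by rewrite /t; have : Num.min 1 e <= 1 by [rewrite ge_min lexx]; lra.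
  have te : t < e by rewrite /t; have : Num.min 1 e <= e by [rewrite ge_min lexx orbT]; lra.
  (* A point of that curve: [zeta ^ a_i' = -1]. *)
  pose zeta : C := expi2pi (2 * (a i')%:R)^-1.
  have zetaE : zeta ^+ a i' = -1.
    rewrite expi2piXn invfM mulrCA mulfV ?mulr1; last first.
      by rewrite pnatr_eq0; have := a2 i'; lia.
    rewrite /expi2pi mulrAC mulfV ?mul1r ?pnatr_eq0 // cospi sinpi.
    by apply/eqP; rewrite eq_complex /= oppr0 !eqxx.
  pose x c : C := if c == i then (t ^+ a i')%:C%C
                  else if c == i' then zeta * (t ^+ a i)%:C%C else 0.
  have xj : x j = 0 by rewrite /x (negPf ji) (negPf ji').
  have small q : (2 <= q)%N -> `|(t ^+ q)%:C%C| < e%:C%C :> C.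
    move=> q2; rewrite normc_def /= expr0n addr0 sqrtr_sqr ltcR.
    rewrite ger0_norm ?exprn_ge0 ?ltW //; apply: le_lt_trans te.
    case: q q2 => // q _; rewrite exprS; apply: ler_piMr; first exact: ltW.
    by apply: exprn_ile1 => //; exact: ltW.
  suff /(_ i) : forall c, x c = 0.
    rewrite /x eqxx => /complexI /eqP; rewrite expf_eq0 => /andP [_ /eqP t00].
    by rewrite t00 ltxx in t0.
  apply: Hx => [c|b].
    rewrite /x; case: ifP => _; first exact: small.
    case: ifP => _; first by rewrite normrM norm_expi2pi mul1r small.
    by rewrite normr0 ltcR.
  rewrite meval_deriv (reindex_inj linj) /=.
  rewrite (bigD1 i) //= [X in _ + X](bigD1 i') /=; last by rewrite eq_sym.
  rewrite [X in _ + (_ + X)]big1 ?addr0; last first.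
    move=> y /andP [yi yi']; rewrite (prod_eq0 (c := y)) ?mulr0 //.
      by rewrite /x (negPf yi) (negPf yi').
    rewrite AE eqxx muln1 subn_gt0 ltn_addr // (leq_trans _ (a2 y)) //.
    by case: (b == y).
  have [bj|bj] := eqVneq b j; last first.
    rewrite !(prod_eq0 (c := j)) ?mulr0 ?addr0 // AE ?ki ?ki' eqxx (negPf bj).
      by rewrite subn0 addn1.
    by rewrite subn0 addn1.
  have prodE y : k y = Some j -> \prod_c x c ^+ (A (l y) c - (b == c)) = x y ^+ a y.
    move=> ky; rewrite (bigD1 y) //= big1 ?mulr1 => [|c cy]; rewrite AE ky bj.
      by rewrite (inj_eq Some_inj) eqxx muln1 addnK.
    by rewrite (inj_eq Some_inj) eq_sym (negPf cy) muln0 add0n subnn expr0.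
  rewrite !prodE // !AE ki ki' bj eqxx !(eq_sym _ j) (negPf ji) (negPf ji').
  rewrite !muln0 !add0n !mul1r /x eqxx [i' == i]eq_sym (negPf ii') eqxx.
  rewrite [X in _ + X]exprMn zetaE mulN1r -!rmorphXn /= -!exprM [X in _ - (t ^+ X)%:C%C]mulnC.
  by rewrite subrr.
pose p j := [pick i | k i == Some j].
exists (perm linj), a, k, p; split=> [|i j]; last by rewrite permE AE.
split=> // i j; rewrite /p; case: pickP => [i' /eqP ki'|none].
  by apply/eqP/eqP => [ki|[<-] //]; rewrite (kinj _ _ _ ki ki').
by rewrite none.
Qed.
End KreuzerSkarke.

(** * Generators and the dual group *)

Lemma exponent_mx_tr N (A : 'M[nat]_N) : exponent_mx A^T = (exponent_mx A)^T.
Proof. by apply/matrixP => i j; rewrite !mxE. Qed.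

Definition pairing N (A : 'M[nat]_N) (r b : 'I_N -> int) : rat :=
  (\row_i (r i)%:~R *m invmx (exponent_mx A) *m \col_i (b i)%:~R) 0 0.

Lemma pairing_tr N (A : 'M[nat]_N) r b : pairing A^T r b = pairing A b r.
Proof.
have tr (X : 'M[rat]_1) : X 0 0 = X^T 0 0 by rewrite mxE.
rewrite /pairing exponent_mx_tr -trmx_inv [LHS]tr !trmx_mul trmxK mulmxA.
by congr ((_ *m _ *m _) _ _); apply/matrixP => i j; rewrite !mxE.
Qed.

Section Groups.
Variables (R : realType) (N : nat) (A : 'M[nat]_N) (s : 'S_N).
Variables (a : 'I_N -> nat) (k p : 'I_N -> option 'I_N).
Hypothesis AM : arrow_matrix A s a k p.
Local Notation C := R[i].
Local Notation E := (exponent_mx A).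
Let S := am_arrows AM.
Implicit Types (g h : 'I_N -> C) (r b : 'I_N -> int).

Lemma row_inj i i' : A i =1 A i' -> i = i'.
Proof.
rewrite -(permKV s i) -(permKV s i'); set j := (s^-1)%g i; set j' := (s^-1)%g i'.
move=> /(_ j); rewrite !(amE AM) eqxx; have [-> //|jj'] := eqVneq j' j.
have := arrows_ge2 S j; case: (_ == _); case: (_ == _); lia.
Qed.

Lemma Gmax_diag_sym g : Gmax A g -> diag_sym A g.
Proof.
case=> g0 gA i; pose m l := [multinom A l j | j < N].
have gX l : 'X_[m l] \mPo [tuple g i *: 'X_i | i < N] =
    (\prod_j g j ^+ A l j) *: 'X_[m l] :> {mpoly C[N]}.
  rewrite comp_mpolyX (eq_bigr (fun j => g j ^+ A l j *: 'X_j ^+ m l j)).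
    by rewrite scaler_prod -mpolyXE_id.
  by move=> j _; rewrite tnth_mktuple exprZn mnmE.
have mi l : (m l == m i) = (l == i).
  apply/eqP/eqP => [e|-> //]; apply: row_inj => j.
  by have /mnmP /(_ j) := e; rewrite !mnmE.
have := congr1 (mcoeff (m i)) gA.
rewrite (potential_row R A) (raddf_sum (comp_mpoly _)) !(raddf_sum (mcoeff (m i))).
rewrite (bigD1 i) //= [X in _ + X]big1 ?addr0 => [|l li]; last first.
  by rewrite gX mcoeffZ mcoeffX mi (negPf li) mulr0.
rewrite [RHS](bigD1 i) //= [X in _ = _ + X]big1 ?addr0 => [|l li]; last first.
  by rewrite mcoeffX mi (negPf li).
by rewrite gX mcoeffZ mcoeffX eqxx mulr1.
Qed.

Lemma rho_prodE b : rho_prod R A b =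
  (fun j => expi2pi (ratr ((invmx E *m \col_i (b i)%:~R) j 0))) :> ('I_N -> C).
Proof.
apply/funext => j; rewrite /rho_prod /rho mxE rmorph_sum expi2pi_sum.
apply: eq_bigr => i _; rewrite expi2piXz mxE rmorphM /= ratr_int mulrC.
by [].
Qed.

Lemma diag_sym_rho b : diag_sym A (rho_prod R A b : 'I_N -> C).
Proof.
rewrite rho_prodE; apply/(diag_sym_expq R AM) => i.
rewrite -(exponent_mx_row AM) mulmxA mulmxV ?(exponent_mx_unit AM) //.
by rewrite mul1mx mxE intr_int.
Qed.

Lemma diag_sym_rhoP g : diag_sym A g -> exists b, g = rho_prod R A b.
Proof.
move=> gA; have [x _ gx] := diag_sym_expi AM gA.
have xZ : forall i, rowexp a k x i \is a Num.int.
  apply/(diag_sym_expq R AM).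
  by rewrite (_ : (fun j => _) = g) //; apply/funext => j; rewrite gx.
have /choice [b bx] : forall i, exists b : int, rowexp a k x i = b%:~R.
  by move=> i; apply/intrP; exact: xZ.
have xE : \col_j x j = invmx E *m \col_i (b ((s^-1)%g i))%:~R.
  rewrite -[LHS](mulKmx (exponent_mx_unit AM)); congr (_ *m _).
  apply/colP => i; rewrite -(permKV s i) (exponent_mx_row AM) [RHS]mxE permK -bx.
  by congr (rowexp _ _ _ _); apply/funext => l; rewrite mxE.
exists (fun i => b ((s^-1)%g i)); rewrite rho_prodE; apply/funext => j.
by rewrite gx -xE mxE.
Qed.

Lemma prod_rho r b :
  \prod_j (rho_prod R A b j : C) ^ r j = expi2pi (ratr (pairing A r b)).
Proof.
rewrite rho_prodE; under eq_bigr => j _ do rewrite expi2piXz -(ratr_int R) -rmorphM.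
rewrite -expi2pi_sum -rmorph_sum /pairing -mulmxA mxE; congr (expi2pi (ratr _)).
by apply: eq_bigr => j _; rewrite [in RHS]mxE.
Qed.

Lemma rho_prodD b b' : rho_prod R A (fun i => b i + b' i) =
  (fun j => rho_prod R A b j * rho_prod R A b' j) :> ('I_N -> C).
Proof.
rewrite !rho_prodE; apply/funext => j; rewrite -expi2piD -rmorphD /=.
have -> : \col_i (b i + b' i)%:~R = \col_i (b i)%:~R + \col_i (b' i)%:~R :> 'cV[rat]_N.
  by apply/colP => i; rewrite !mxE intrD.
by rewrite mulmxDr [X in ratr X]mxE.
Qed.

Lemma rho_prodN b : rho_prod R A (fun i => - b i) =
  (fun j => (rho_prod R A b j)^-1) :> ('I_N -> C).
Proof.
rewrite !rho_prodE; apply/funext => j; rewrite -expi2piN -rmorphN /=.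
have -> : \col_i (- b i)%:~R = - \col_i (b i)%:~R :> 'cV[rat]_N.
  by apply/colP => i; rewrite !mxE intrN.
by rewrite mulmxN [X in ratr X]mxE.
Qed.
End Groups.

Section Duality.
Variables (R : realType) (N : nat) (A : 'M[nat]_N) (s : 'S_N).
Variables (a : 'I_N -> nat) (k p : 'I_N -> option 'I_N).
Hypothesis AM : arrow_matrix A s a k p.
Local Notation C := R[i].
Local Notation E := (exponent_mx A).
Variable G : set ('I_N -> C).
Hypotheses (G_group : torus_subgroup G) (G_dsym : forall g, G g -> diag_sym A g).

Lemma dual_diag_sym g : dual_group A G g -> diag_sym A^T g.
Proof. by case=> r -> _; exact: diag_sym_rho (arrow_matrix_tr AM) r. Qed.

Lemma prod_rho_tr r b :
  \prod_i (rho_prod R A^T r i : C) ^ b i = expi2pi (ratr (pairing A r b)).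
Proof. by rewrite (prod_rho R A^T) pairing_tr. Qed.

(** By [prod_rho], the value of the character [r] at [rho ^ b] is
    [exp (2 i pi r A^-1 b)], and every element of [G] is of the form [rho ^ b]. *)
Lemma mem_dual r : dual_group A G (rho_prod R A^T r) <->
  forall g, G g -> \prod_j g j ^ r j = 1.
Proof.
split=> [[r' re H] g Gg|H].
  have [b gb] := diag_sym_rhoP AM (G_dsym Gg); rewrite gb in Gg *.
  rewrite prod_rho -prod_rho_tr re prod_rho_tr; apply/eqP.
  by rewrite expq_eq1; exact: H.
exists r => // b Gb; rewrite -[X in X \is a _]/(pairing A r b).
by rewrite -(expq_eq1 R) -prod_rho H.
Qed.

(** The vectors [b] with [rho ^ b] in [G] form a lattice that contains the image of
    [A]; a functional separating [b] from it yields an element of the dual group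
    on which the character [b] is not trivial. *)
Lemma mem_double_dual b : G (rho_prod R A b) <->
  forall g, dual_group A G g -> \prod_i g i ^ b i = 1.
Proof.
split=> [Gb g [r -> H]|H].
  by apply/eqP; rewrite prod_rho_tr expq_eq1; exact: H.
apply: contrapT => nGb.
pose Z : 'M[int]_N := map_mx (fun n : nat => n%:Z) A.
have ZE : map_mx intr Z = E by apply/matrixP => i j; rewrite !mxE.
pose L (x : 'cV[int]_N) := G (rho_prod R A (x^~ 0)).
have G1 : G (fun=> 1) by case: G_group.
have rhoZ (e : 'cV[int]_N) : rho_prod R A ((Z *m e)^~ 0) = (fun=> 1) :> ('I_N -> C).
  rewrite rho_prodE; apply/funext => j; apply/eqP; rewrite expq_eq1.
  rewrite (_ : \col_i _ = E *m map_mx intr e).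
    by rewrite mulKmx ?(exponent_mx_unit AM) // mxE intr_int.
  by rewrite -ZE -map_mxM; apply/colP => i; rewrite !mxE.
have [||||||psi [r rE] [psiL]] := @lattice_separation N Z L (\col_i b i).
- rewrite -(intr_eq0 rat) -det_map_mx ZE -unitfE -unitmxE.
  exact: exponent_mx_unit AM.
- by have := rhoZ 0; rewrite mulmx0 /L => ->.
- move=> x y Lx Ly; rewrite /L (_ : _^~ 0 = fun i => x i 0 + y i 0).
    by rewrite rho_prodD; case: G_group => _ H' _; exact: H'.
  by apply/funext => i; rewrite mxE.
- move=> x Lx; rewrite /L (_ : _^~ 0 = fun i => - x i 0).
    by rewrite rho_prodN; case: G_group => _ _; exact.
  by apply/funext => i; rewrite mxE.
- by move=> e; rewrite /L rhoZ.
- rewrite /L (_ : _^~ 0 = b) //; by apply/funext => i; rewrite mxE.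
have pE x : pairing A (r 0) x = (psi *m \col_i (x i)%:~R) 0 0.
  rewrite /pairing (_ : \row_i _ = psi *m E) ?mulmxK ?(exponent_mx_unit AM) //.
  by rewrite -ZE -rE; apply/rowP => i; rewrite !mxE.
have colE' (x : 'I_N -> int) : map_mx intr (\col_i x i) = \col_i (x i)%:~R :> 'cV[rat]_N.
  by apply/colP => i; rewrite !mxE.
rewrite colE' -pE -(expq_eq1 R) -prod_rho_tr H ?eqxx //.
exists (r 0) => // x Gx; rewrite -[X in X \is a _]/(pairing A (r 0) x) pE -colE'.
apply: psiL; rewrite /L (_ : _^~ 0 = x) //.
by apply/funext => i; rewrite mxE.
Qed.
End Duality.

(** * Exchange of mirror pairs *)

Definition swap N M (d : code N M) : code N M := (d.2, d.1).

Lemma swapK N M : involutive (@swap N M).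
Proof. by case. Qed.

Lemma ucol_swap N M (A : 'M[nat]_N) (d : code N M) :
  ucol A^T (swap d) =1 trow A d.
Proof.
move=> i; rewrite /ucol exponent_mx_tr -trmx_inv.
have -> : trow A d i = (\row_j (d.2 j)%:R *m invmx (exponent_mx A))^T i 0.
  by rewrite [RHS]mxE.
by rewrite trmx_mul; congr ((_ *m _) _ _); apply/colP => j; rewrite !mxE.
Qed.

Lemma trow_swap N M (A : 'M[nat]_N) (d : code N M) :
  trow A^T (swap d) =1 ucol A d.
Proof.
move=> i; have := ucol_swap A^T (swap d) i; rewrite swapK trmxK => ->.
by [].
Qed.

Section Swap.
Variables (R : realType) (N : nat) (A : 'M[nat]_N) (s : 'S_N).
Variables (a : 'I_N -> nat) (k p : 'I_N -> option 'I_N).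
Hypothesis AM : arrow_matrix A s a k p.
Variable M : nat.
Local Notation C := R[i].
Let S := am_arrows AM.
Local Notation si := (s^-1)%g.
Local Notation kT := (fun v => omap s (p (si v))).
Local Notation pT := (fun v => omap s (k (si v))).
Local Notation code := (code N M).
Local Notation is_mirrorT := (is_mirror A^T si kT pT).
Local Notation is_mirror := (is_mirror A s k p).
Local Notation sector_ofT := (sector_of R A^T).
Local Notation sector_of := (sector_of R A).
Local Notation u := (ucol A).
Local Notation w := (wrow A s).
Implicit Types (d : code).

Lemma ucolT d v : ucol A^T (swap d) v = w d (si v).
Proof. by rewrite ucol_swap /wrow permKV. Qed.

Lemma wrowT d v : wrow A^T si (swap d) v = u d (si v).
Proof. by rewrite /wrow trow_swap. Qed.

Lemma mirror_pair_tr (x y : 'I_N -> rat) :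
  mirror_pair kT pT (fun v => y (si v)) (fun v => x (si v)) <-> mirror_pair k p x y.
Proof.
have omapE (o : option 'I_N) l : omap s o = Some l -> o = Some (si l).
  by case: o => //= i [<-]; rewrite permK.
split=> [[y01 x01 yx x1 y1]|[x01 y01 xy y1 x1]]; split.
- by move=> j; have := x01 (s j); rewrite permK.
- by move=> j; have := y01 (s j); rewrite permK.
- by move=> j; have := yx (s j); rewrite permK => ->; rewrite negbK.
- move=> j yj; have [|l] := y1 (s j); rewrite permK // => /omapE kj xl.
  by exists (si l).
- move=> j xj; have [|l] := x1 (s j); rewrite permK // => /omapE pj yl.
  by exists (si l).
- by move=> v; exact: y01.
- by move=> v; exact: x01.
- by move=> v; rewrite xy negbK.
- move=> v /x1 [l pl yl]; exists (s l); last by rewrite permK.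
  by rewrite pl.
- move=> v /y1 [l kl xl]; exists (s l); last by rewrite permK.
  by rewrite kl.
Qed.

Lemma is_mirror_swap d : is_mirrorT (swap d) = is_mirror d.
Proof.
have uT : ucol A^T (swap d) = fun v => w d (si v).
  by apply/funext => v; rewrite ucolT.
have wT : wrow A^T si (swap d) = fun v => u d (si v).
  by apply/funext => v; rewrite wrowT.
have := mirror_pair_tr (u d) (w d); rewrite -uT -wT => -[H1 H2].
by apply/asboolP/asboolP.
Qed.

Lemma sec_rho d : sector_of d = rho_prod R A (fun i => (d.1 i : nat)%:Z).
Proof. by rewrite rho_prodE. Qed.

(** Lying in the group and being invariant are exchanged by duality. *)
Lemma admissible_swap (G : set ('I_N -> C)) d : torus_subgroup G ->
  (forall g, G g -> diag_sym A g) ->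
  admissible A G d <-> admissible A^T (dual_group A G) (swap d).
Proof.
move=> Gg GA; rewrite /admissible sec_rho.
have -> : sector_ofT (swap d) = rho_prod R A^T (fun i => (d.2 i : nat)%:Z).
  by rewrite rho_prodE.
have E1 := mem_double_dual AM Gg (fun i => (d.1 i : nat)%:Z).
have E2 := mem_dual AM GA (fun i => (d.2 i : nat)%:Z).
by split=> -[H1 H2]; split; [apply/E2|apply/E1|apply/E1|apply/E2].
Qed.

(** * Matching of the bidegrees *)

(** The arrows match the ones of [u] with those of [w]. *)
Lemma sum_ones d : is_mirror d ->
  \sum_j (u d j == 1)%:R = \sum_j (w d j == 1)%:R :> rat.
Proof.
move/asboolP => D.
have kp i j : k i = Some j -> p j = Some i by exact: (arrows_prev S).
have pk i j : p j = Some i -> k i = Some j by exact: (arrows_next S).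
have wE j : (w d j == 1)%:R = oapp (fun l => (u d l == 1)%:R) 0 (k j) :> rat.
  case: eqP => [/(mp_w1 D) [l -> e]|w1]; first by rewrite /= e eqxx.
  case kj : (k j) => [l|] //=; case: eqP => // /(mp_u1 D) [j' pj wj'].
  by have := kp _ _ kj; rewrite pj => -[e]; rewrite e in wj'.
have uE j : (u d j == 1)%:R = oapp (fun l => (w d l == 1)%:R) 0 (p j) :> rat.
  case: eqP => [/(mp_u1 D) [l -> e]|u1]; first by rewrite /= e eqxx.
  case pj : (p j) => [l|] //=; case: eqP => // /(mp_w1 D) [j' kj uj'].
  by have := pk _ _ pj; rewrite kj => -[e]; rewrite e in uj'.
apply: le_anti; apply/andP; split.
  by rewrite (eq_bigr _ (fun j _ => uE j)) (sum_pre_le S) // => i; exact: ler0n.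
by rewrite (eq_bigr _ (fun j _ => wE j)) (sum_pre_le (arrows_rev S)) // => i; exact: ler0n.
Qed.

(** Both sums are the sum of all the entries of [A^-1]. *)
Lemma sum_charge : \sum_j charge A^T j 0 = \sum_j charge A j 0.
Proof.
have E1 (B : 'M[nat]_N) : \sum_j charge B j 0 = (const_mx 1 *m charge B : 'M_1) 0 0.
  by rewrite mxE; apply: eq_bigr => j _; rewrite [X in X * _]mxE mul1r.
rewrite !E1 /charge exponent_mx_tr -trmx_inv.
have tr (X : 'M[rat]_1) : X 0 0 = X^T 0 0 by rewrite mxE.
by rewrite [LHS]tr !trmx_mul trmxK !trmx_const mulmxA.
Qed.

Lemma phase_sec0 d j : is_mirror d -> (phase (sector_of d j) == 0) = is01 (u d j).
Proof.
move=> Dd; rewrite (phase_sec R j Dd) /is01.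
by case: (u d j == 1); rewrite ?eqxx ?orbT // fmorph_eq0 orbF.
Qed.

Lemma QplusE d : is_mirror d ->
  QA_plus A (sector_of d) =
  ratr (\sum_(j | ~~ is01 (u d j)) (u d j - charge A j 0)) :> R.
Proof.
move=> Dd; rewrite /QA_plus rmorph_sum; apply: eq_big => [j|j].
  by rewrite phase_sec0.
rewrite (phase_sec0 _ Dd) (phase_sec R j Dd) /is01 negb_or => /andP [_ /negPf ->].
by rewrite rmorphB.
Qed.

End Swap.

Section Bidegree.
Variables (R : realType) (N : nat) (A : 'M[nat]_N) (s : 'S_N).
Variables (a : 'I_N -> nat) (k p : 'I_N -> option 'I_N).
Hypothesis AM : arrow_matrix A s a k p.
Variable M : nat.
Local Notation code := (code N M).
Local Notation is_mirror := (is_mirror A s k p).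
Local Notation sector_of := (sector_of R A).
Local Notation u := (ucol A).
Local Notation w := (wrow A s).
Implicit Types (d : code).

Lemma bidegAE d : is_mirror d -> bidegA A (local_monomial (fix_set (sector_of d)) d) =
  (ratr (\sum_j ((u d j) *+ (~~ is01 (u d j)) + w d j - charge A j 0)),
   ratr (\sum_j ((u d j) *+ (~~ is01 (u d j)) + (is01 (u d j))%:R - w d j
                 - charge A j 0))) :> R * R.
Proof.
move=> Dd; have fE j : (j \in fix_set (sector_of d)) = is01 (u d j) by exact (fix_sec R j Dd).
rewrite /bidegA (weight_local_monomial AM Dd erefl) (eq_bigl _ _ fE).
rewrite /QA_minus -/(QA_plus A (sector_of d)) (QplusE R Dd).
have -> : \sum_(i | phase (sector_of d i) == 0) (1 - 2 * chargeR R A i) =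
    ratr (\sum_(j | is01 (u d j)) (1 - 2 * charge A j 0)) :> R.
  rewrite rmorph_sum; apply: eq_big => [j|j _]; first by rewrite (phase_sec0 R _ Dd).
  by rewrite /chargeR rmorphB rmorphM /= rmorph1 ratr_nat.
rewrite -!rmorphD -rmorphB /=.
congr (ratr _, ratr _); rewrite !(big_mkcond (fun j => is01 _)) (big_mkcond (fun j => ~~ _)) /=.
  rewrite -sumrB -big_split /=; apply: eq_bigr => j _.
  by case: (is01 _) => /=; rewrite ?mulr1n ?mulr0n; ring.
rewrite -!sumrB -!big_split /= -sumrB; apply: eq_bigr => j _.
by case: (is01 _) => /=; rewrite ?mulr1n ?mulr0n; ring.
Qed.

Lemma bidegBE d : is_mirror d -> bidegB A (local_monomial (fix_set (sector_of d)) d) =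
  (ratr (\sum_j ((u d j) *+ (~~ is01 (u d j)) + w d j - charge A j 0)),
   ratr (\sum_j ((~~ is01 (u d j))%:R - (u d j) *+ (~~ is01 (u d j)) + w d j
                 - charge A j 0))) :> R * R.
Proof.
move=> Dd; have fE j : (j \in fix_set (sector_of d)) = is01 (u d j) by exact (fix_sec R j Dd).
rewrite /bidegB (weight_local_monomial AM Dd erefl) (eq_bigl _ _ fE).
rewrite /QB_plus -/(QA_plus A (sector_of d)) (QplusE R Dd).
have -> : QB_minus A (sector_of d) =
    ratr (\sum_(j | ~~ is01 (u d j)) (1 - u d j - charge A j 0)) :> R.
  rewrite /QB_minus rmorph_sum; apply: eq_big => [j|j].
    by rewrite (phase_sec0 R _ Dd).
  rewrite (phase_sec0 R _ Dd) (phase_sec R j Dd) /is01 negb_or => /andP [_ /negPf ->].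
  by rewrite !rmorphB rmorph1.
rewrite -!rmorphD /=.
congr (ratr _, ratr _); rewrite !(big_mkcond (fun j => is01 _)) (big_mkcond (fun j => ~~ _)) /=.
  rewrite -sumrB -big_split /=; apply: eq_bigr => j _.
  by case: (is01 _) => /=; rewrite ?mulr1n ?mulr0n; ring.
rewrite -!sumrB -!big_split /=; apply: eq_bigr => j _.
by case: (is01 _) => /=; rewrite ?mulr1n ?mulr0n; ring.
Qed.
End Bidegree.

(** Up to the sum of the charges, the two components are sums over [j] of linear
    functions of [u_j], [w_j] and of the indicators of [u_j = 1] and [w_j = 1].
    The first components differ by the numbers of ones of [u] and [w]; the second
    ones agree for each [j], as exactly one of [u_j] and [w_j] vanishes. *)
Lemma bideg_swap (R : realType) N (A : 'M[nat]_N) s a k p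
    (AM : arrow_matrix A s a k p) M (d : code N M) : is_mirror A s k p d ->
  bidegA A (local_monomial (fix_set (sector_of R A d)) d) =
  bidegB A^T (local_monomial (fix_set (sector_of R A^T (swap d))) (swap d)).
Proof.
move=> Dd; rewrite (bidegAE R AM Dd) (bidegBE R (arrow_matrix_tr AM)); last first.
  by rewrite is_mirror_swap.
have ones := sum_ones AM Dd; move/asboolP: (Dd) => D.
have splitE (x : rat) : x = x *+ (~~ is01 x) + (x == 1)%:R.
  rewrite /is01; have [->|x1] := eqVneq x 1.
    by rewrite orbT mulr0n add0r.
  by rewrite orbF addr0; have [->|x0] := eqVneq x 0; rewrite ?mul0rn ?mulr1n.
have bndE j : (is01 (ucol A d j))%:R = (~~ is01 (wrow A s d j))%:R +
    (ucol A d j == 1)%:R + (wrow A s d j == 1)%:R :> rat.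
  have := mp_uw D j; rewrite /is01.
  have [w0|w0] := eqVneq (wrow A s d j) 0.
    by rewrite w0 => /negbT /negPf -> /=; rewrite add0r addr0.
  by move=> /eqP ->; have [w1|w1] := eqVneq (wrow A s d j) 1.
have qE : \sum_j charge A^T (s j) 0 = \sum_j charge A j 0.
  by rewrite -sum_charge [RHS](reindex_inj (@perm_inj _ s)).
congr (ratr _, ratr _); rewrite [RHS](reindex_inj (@perm_inj _ s)) /=;
  under [RHS]eq_bigr => j _ do rewrite (ucolT A s) (wrowT A s) !permK.
  rewrite !sumrB qE; congr (_ - _); rewrite !big_split /=.
  under [X in _ + X = _]eq_bigr => j _ do rewrite (splitE (wrow A s d j)).
  under [X in _ = _ + X]eq_bigr => j _ do rewrite (splitE (ucol A d j)).
  by rewrite !big_split /= ones addrCA.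
rewrite sumrB [RHS]sumrB qE; congr (_ - _); apply: eq_bigr => j _.
rewrite bndE; have := splitE (wrow A s d j); have := splitE (ucol A d j).
move: (ucol A d j *+ ~~ is01 _) (wrow A s d j *+ ~~ is01 _) => u' w'.
by move: (_ == 1)%:R (_ == 1)%:R (~~ _)%:R => x y z -> ->; ring.
Qed.

(** * The mirror isomorphism *)

Section Linearity.
Variables (R : realType) (N : nat) (A : 'M[nat]_N) (s : 'S_N).
Variables (a : 'I_N -> nat) (k p : 'I_N -> option 'I_N).
Hypothesis AM : arrow_matrix A s a k p.
Variable M : nat.
Local Notation V := (potential R A).
Local Notation code := (code N M).
Local Notation is_mirror := (is_mirror A s k p).

Lemma scoord_linear (d : code) c (x y : sectors V) : is_mirror d ->
  scoord s a k d (c *: x + y) = c * scoord s a k d x + scoord s a k d y.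
Proof. by move=> Dd; exact: (sector_coord_linear AM). Qed.

Lemma eq_assemble (y y' : code -> R[i]) : (forall d, is_mirror d -> y d = y' d) ->
  assemble A s k p y = assemble A s k p y'.
Proof.
move=> e; apply: functional_extensionality_dep => h.
by apply: eq_bigr => d /andP [Dd _]; rewrite e.
Qed.

Lemma assemble_linear c (y y' : code -> R[i]) :
  assemble A s k p (fun d => c * y d + y' d) = c *: assemble A s k p y + assemble A s k p y'.
Proof.
apply: functional_extensionality_dep => h.
rewrite -[RHS]/(c *: assemble A s k p y h + assemble A s k p y' h) /assemble scaler_sumr.
rewrite -big_split /=; apply: eq_bigr => d _.
by rewrite scalerA -scalerDl.
Qed.
End Linearity.

Theorem theorem1p1 (R : realType) (N : nat) (A : 'M[nat]_N)
    (W_nondeg : non_degenerate R A) (A_ge2 : exponents_ge2 A)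
    (G : set ('I_N -> R[i]))
    (G_group : torus_subgroup G) (G_sub : (G `<=` Gmax A)%classic) :
  exists f : {linear A_model A G -> B_model A^T (dual_group A G)},
    bijective f /\
    forall (d : R * R) (x : A_model A G), A_bidegree d x <-> B_bidegree d (f x).
Proof.
have [s [a [k [p AM]]]] := kreuzer_skarke A_ge2 W_nondeg.2.
have AMT := arrow_matrix_tr AM.
set si := (s^-1)%g in AMT; set aT := (fun v => a _) in AMT.
set kT := (fun v => omap s (p _)) in AMT; set pT := (fun v => omap s (k _)) in AMT.
have G_dsym g : G g -> diag_sym A g by move=> /G_sub gG; exact: (Gmax_diag_sym AM gG).
have GT_dsym g : dual_group A G g -> diag_sym A^T g by move=> gG; exact: (dual_diag_sym AM gG).
pose M := (\max_i a i).+1.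
have aM j : (a j < M)%N by rewrite ltnS leq_bigmax.
have aMT v : (aT v < M)%N by exact: aM.
pose isd (d : code N M) := is_mirror A s k p d.
pose isdT (d : code N M) := is_mirror A^T si kT pT d.
have isdTE d : isdT (swap d) = isd d by exact: is_mirror_swap.
have isdTE' d : isdT d = isd (swap d) by rewrite -{1}(swapK d) isdTE.
(* Both maps exchange the components of the mirror pairs. *)
pose F (x : sectors (potential R A)) : sectors (potential R A^T) :=
  assemble A^T si kT pT (fun d : code N M => scoord s a k (swap d) x).
pose H (y : sectors (potential R A^T)) : sectors (potential R A) :=
  assemble A s k p (fun d : code N M => scoord si aT kT (swap d) y).
have FP x : x \in state_pred G -> F x \in state_pred (dual_group A G).
  move=> xG; apply: (assemble_state AMT) => d Dd cd.
  rewrite -(swapK d); apply/(admissible_swap AM _ G_group G_dsym).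
  by apply: (state_admissible AM G_dsym xG) => //; rewrite -/(isd _) -isdTE'.
have HP y : y \in state_pred (dual_group A G) -> H y \in state_pred G.
  move=> yG; apply: (assemble_state AM) => d Dd cd.
  apply/(admissible_swap AM _ G_group G_dsym).
  by apply: (state_admissible AMT GT_dsym yG) => //; rewrite -/(isdT _) isdTE.
have FK x : x \in state_pred G -> H (F x) = x.
  move=> /asboolP [_ xG _]; rewrite -[RHS](assemble_scoord AM aM) => [|h /xG /G_dsym //].
  apply: eq_assemble => d Dd; rewrite (scoord_assemble AMT) ?swapK //.
  by rewrite -/(isdT _) isdTE.
have HK y : y \in state_pred (dual_group A G) -> F (H y) = y.
  move=> /asboolP [_ yG _]; rewrite -[RHS](assemble_scoord AMT aMT) => [|h /yG /GT_dsym //].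
  apply: eq_assemble => d Dd; rewrite (scoord_assemble AM) ?swapK //.
  by rewrite -/(isd _) -isdTE'.
pose f0 (x : A_model A G) : B_model A^T (dual_group A G) :=
  exist _ (F (val x)) (FP _ (valP x)).
have F_lin c x y : F (c *: x + y) = c *: F x + F y.
  rewrite /F -[RHS]assemble_linear; apply: eq_assemble => d Dd.
  by apply: (scoord_linear AM); rewrite -/(isd _) -isdTE'.
have f0_lin : linear f0 by move=> c x y; apply: val_inj; exact: F_lin.
pose f : {linear A_model A G -> B_model A^T (dual_group A G)} :=
  HB.pack f0 (GRing.isLinear.Build _ _ _ _ f0 f0_lin).
exists f; split.
  exists (fun y => exist _ (H (val y)) (HP _ (valP y))) => x; apply: val_inj.
    exact: FK (valP x).
  exact: HK (valP x).
move=> b x; rewrite /A_bidegree /B_bidegree.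
have bwA h (m m' : 'X_{1..#|fix_set h|}) :
    weight (R := R) A m = weight A m' -> bidegA A m = bidegA A m'.
  by rewrite /bidegA => ->.
have bwB h (m m' : 'X_{1..#|fix_set h|}) :
    weight (R := R) A^T m = weight A^T m' -> bidegB A^T m = bidegB A^T m'.
  by rewrite /bidegB => ->.
apply: iff_trans (has_bidegreeE AM aM x b bwA G_dsym) _.
apply: iff_trans (iff_sym (has_bidegreeE AMT aMT (f x) b bwB GT_dsym)).
split=> E d Dd c0.
  rewrite -(swapK d) -(bideg_swap R AM) -/(isd _) -?isdTE' //.
  apply: E; first by rewrite -/(isd _) -isdTE'.
  by move: c0; rewrite (scoord_assemble AMT).
rewrite (bideg_swap R AM) //; apply: E; first by rewrite -/(isdT _) isdTE.
by rewrite (scoord_assemble AMT) ?swapK // -/(isdT _) isdTE.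
Qed.
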